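(* Let $V$ be a vector space over a field $\mathbb{F}$, let $I$ be a set, and let $k$ be a natural number with $1 \leq k < \dim_{\mathbb{F}} V$. Then $V$ is a union of ''$I$-many'' proper subspaces of codimension at least $k$ (that is, there is a family $(V_i)_{i \in I}$ of proper $\mathbb{F}$-subspaces of $V$, each of codimension at least $k$ in $V$, with $V = \bigcup_{i \in I} V_i$) if and only if $I \geq \nu(\mathbb{F}, V, k)$, where \[ \nu(\mathbb{F},V,k) := \begin{cases} \left\lceil \dfrac{|\mathbb{P}(V)|}{|\mathbb{P}(V/\mathbb{F}^k)|} \right\rceil, & \text{if } |V| < \infty;\\[2mm] \mathbb{N}, & \text{if } \mathbb{F} \text{ and } \dim_{\mathbb{F}} V \text{ are both infinite};\\ \mathbb{F}^k \coprod \{\infty\}, & \text{otherwise.} \end{cases} \]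
   Context: Sets are compared by cardinality: for sets $I, J$, write $J > I$ if there is no one-to-one map $J \to I$; otherwise write $J \leq I$ (equivalently $I \geq J$). Cardinal numbers and sets are used interchangeably in such comparisons: for a natural number $n$, $I \geq n$ means $I \geq \{1,2,\dots,n\}$. ''$I$-many'' subspaces means a family of subspaces indexed by the set $I$; the members of the family need not be distinct. For a vector space $W$ over $\mathbb{F}$, $\mathbb{P}(W)$ denotes the set of lines (one-dimensional subspaces) in $W$, so $\mathbb{P}(W)$ is in bijection with $(W \setminus \{0\})/\mathbb{F}^\times$. The notation $V/\mathbb{F}^k$ denotes the quotient of $V$ by a $k$-dimensional subspace. The set $\mathbb{F}^k \coprod \{\infty\}$ is the set of $k$-tuples of elements of $\mathbb{F}$ together with one additional element. The dimension $\dim_{\mathbb{F}} V$ may be finite or infinite. *)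

(* Defs.v *)
From HB Require Import structures.
From mathcomp Require Import all_boot all_order all_algebra finmap.
From mathcomp Require Import all_classical.

Set Implicit Arguments.
Unset Strict Implicit.
Unset Printing Implicit Defensive.

Import GRing.Theory.

Local Open Scope classical_set_scope.
Local Open Scope ring_scope.
Local Open Scope card_scope.

Section Dimension.
Variables (F : fieldType) (V : lmodType F).
Implicit Types (U B : set V).

Definition lin_span B : set V :=
  [set x | exists (s : {fset V}) (c : V -> F),
     [set` s] `<=` B /\ x = \sum_(v <- s) c v *: v].

Definition lin_indep B : Prop :=
  forall (s : {fset V}) (c : V -> F), [set` s] `<=` B ->
    \sum_(v <- s) c v *: v = 0 -> {in s, forall v, c v = 0}.

Definition is_basis U B : Prop :=
  [/\ B `<=` U, lin_indep B & U `<=` lin_span B].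

(* The dimension of a subspace is a cardinal, which is represented by a chosen
   basis (one exists by vdimP): dimensions are compared through #<= and #=;
   in particular ~ (vdim U #<= `I_k) reads k < dim U. *)
Definition vdim (U : submodClosed V) : set V :=
  xget set0 (is_basis [set` U]).

Lemma lin_span_sub B : B `<=` lin_span B.
Proof.
move=> x Bx; exists [fset x]%fset, (fun=> 1).
by rewrite big_seq_fset1 scale1r; split=> // y /=; rewrite inE => /eqP ->.
Qed.

Lemma lin_indepU1 B x :
  lin_indep B -> ~ lin_span B x -> lin_indep (B `|` [set x]).
Proof.
move=> Bi Bx s c sB s0.
have sDB : [set` (s `\ x)%fset] `<=` B.
  move=> v /=; rewrite in_fsetD1 => /andP[/eqP vx vs].
  by have [|] := sB v vs.
have [xs|xs] := boolP (x \in s); last first.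
  apply: Bi s0 => v vs; have [//|vx] := sB v vs.
  by move: vs xs; rewrite /= vx => ->.
move: (s0); rewrite (big_fsetD1 x)//=.
have [cx0|cx0] := eqVneq (c x) 0.
  rewrite cx0 scale0r add0r => /(Bi _ _ sDB) cD v vs.
  have [->//|vx] := eqVneq v x.
  by apply: cD; rewrite in_fsetD1 vx.
move=> /eqP; rewrite addr_eq0 => /eqP cxE; case: Bx.
exists (s `\ x)%fset, (fun v => - ((c x)^-1 * c v)); split=> //.
transitivity ((c x)^-1 *: (c x *: x)); first by rewrite scalerA mulVf// scale1r.
rewrite cxE scalerN scaler_sumr -sumrN; apply: eq_bigr => v _.
by rewrite scaleNr scalerA.
Qed.

Lemma lin_indep_bigcup (C : set (set V)) : total_on C subset ->
  (forall B, C B -> lin_indep B) -> lin_indep (\bigcup_(B in C) B).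
Proof.
move=> Ctot Ci s c sC.
have [[v0 v0s]|s0] := pselect (exists v, v \in s); last first.
  by move=> _ v vs; case: s0; exists v.
suff [B CB sB] : exists2 B, C B & [set` s] `<=` B by exact: (Ci B CB).
have {}sC : forall v, v \in (s : seq V) -> exists2 B, C B & B v.
  by move=> v vs; have [B CB Bv] := sC v vs; exists B.
have [B0 CB0 _] := sC v0 v0s.
have [B CB sB] : exists2 B, C B & forall v, v \in (s : seq V) -> B v.
  elim: (s : seq V) sC => [|a r IH] sC; first by exists B0.
  have [|B1 CB1 rB1] := IH.
    by move=> v vr; apply: sC; rewrite inE vr orbT.
  have [B2 CB2 aB2] := sC a (mem_head _ _).
  have [B12|B21] := Ctot _ _ CB1 CB2.
    exists B2 => // v; rewrite inE => /orP[/eqP->//|/rB1]; exact: B12.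
  exists B1 => // v; rewrite inE => /orP[/eqP->|/rB1//]; exact: B21.
by exists B.
Qed.

Lemma vdimP (U : submodClosed V) : is_basis [set` U] (vdim U).
Proof.
suff [B UB] : exists B, is_basis [set` U] B.
  exact: (xgetPex set0 (ex_intro _ B UB)).
have [|B [[BU Bi] Bmax]] := @Zorn_bigcup V
    [set B | B `<=` [set` U] /\ lin_indep B].
  move=> C CP Ctot; split; last first.
    by apply: lin_indep_bigcup => // B /CP[].
  by move=> v [B /CP[BU _] /BU].
exists B; split=> // x Ux; apply: contrapT => Bx.
apply: (Bmax (B `|` [set x])); last first.
  by split; [move=> v [/BU//|->] | exact: lin_indepU1].
split; first by move=> v Bv; left.
by move=> /(_ x (or_intror erefl)) /lin_span_sub.
Qed.

End Dimension.
Arguments vdim {F V} U.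

Section Subspaces.
Variables (F : fieldType) (V : lmodType F).

Definition fullsubmod : {pred V} := predT.

Fact fullsubmod_closed : subsemimod_closed fullsubmod.
Proof. by []. Qed.

HB.instance Definition _ :=
  GRing.isSubmodClosed.Build F V fullsubmod fullsubmod_closed.

(* A copy of W that is also known to be closed under opposite, as required by
   Quotient.quot. *)
Definition submod_zmod (W : submodClosed V) : {pred V} := W.

Fact submod_zmod_addr (W : submodClosed V) : addr_closed (submod_zmod W).
Proof. exact: rpred0D. Qed.

Fact submod_zmod_oppr (W : submodClosed V) : oppr_closed (submod_zmod W).
Proof. by move=> u Wu; rewrite -scaleN1r; apply: GRing.rpredZ. Qed.

HB.instance Definition _ (W : submodClosed V) :=
  GRing.isAddClosed.Build V (submod_zmod W) (submod_zmod_addr W).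
HB.instance Definition _ (W : submodClosed V) :=
  GRing.isOppClosed.Build V (submod_zmod W) (@submod_zmod_oppr W).

End Subspaces.
Arguments fullsubmod {F} V.

Section LinearQuotient.
Variables (F : fieldType) (V : lmodType F) (W : submodClosed V).
Local Open Scope quotient_scope.

Definition lquot : Type := Quotient.quot (submod_zmod W).
HB.instance Definition _ := GRing.Zmodule.on lquot.
HB.instance Definition _ := EqQuotient.on lquot.

Definition lquot_scale (a : F) (x : lquot) : lquot := \pi_lquot (a *: repr x).

Lemma pi_lquot_eq (x y : V) : (\pi_lquot x = \pi_lquot y) <-> x - y \in W.
Proof.
by split=> [/eqP|xyW]; [|apply/eqP];
  rewrite -(@Quotient.idealrBE V (submod_zmod W)).
Qed.

Lemma pi_lquotD (x y : V) : \pi_lquot (x + y) = \pi_lquot x + \pi_lquot y.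
Proof. exact: (@pi_addr _ _ _ _ _ (Quotient.quot (submod_zmod W))). Qed.

Lemma pi_lquotZ a (x : V) : \pi_lquot (a *: x) = lquot_scale a (\pi_lquot x).
Proof.
apply/pi_lquot_eq; rewrite -scalerBr; apply: rpredZ.
by apply/pi_lquot_eq; rewrite reprK.
Qed.

Fact lquot_scaleA a b (x : lquot) :
  lquot_scale a (lquot_scale b x) = lquot_scale (a * b) x.
Proof. by rewrite -pi_lquotZ scalerA. Qed.

Fact lquot_scale1 : left_id 1 lquot_scale.
Proof. by move=> x; rewrite /lquot_scale scale1r reprK. Qed.

Fact lquot_scaleDr : right_distributive lquot_scale +%R.
Proof.
move=> a x y; rewrite -[in LHS](reprK x) -[in LHS](reprK y).
by rewrite -pi_lquotD -pi_lquotZ scalerDr pi_lquotD.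
Qed.

Fact lquot_scaleDl (x : lquot) : {morph lquot_scale^~ x : a b / a + b}.
Proof. by move=> a b; rewrite /lquot_scale scalerDl pi_lquotD. Qed.

HB.instance Definition _ := GRing.Zmodule_isLmodule.Build F lquot
  lquot_scaleA lquot_scale1 lquot_scaleDr lquot_scaleDl.

End LinearQuotient.

Definition codim (F : fieldType) (V : lmodType F) (W : submodClosed V) :
  set (lquot W) := vdim (fullsubmod (lquot W)).
Arguments codim {F V} W.

Definition lines (F : fieldType) (V : lmodType F) : set (set V) :=
  [set [set` L] | L in [set L : submodClosed V | vdim L #= `I_1]].
Arguments lines {F} V.

Section Nu.
Variables (F : fieldType) (V : lmodType F) (k : nat).

(* |P(V/F^k)|; it does not depend on the k-dimensional subspace U. *)
Definition card_lines_quot : nat :=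
  get [set #|` fset_set (lines (lquot U))|%N |
        U in [set U : submodClosed V | vdim U #= `I_k]].

Definition nu_fin : nat :=
  `|Num.ceil ((#|` fset_set (lines V)|%:R : rat) / card_lines_quot%:R)|%N.

(* A natural number n is represented by 'I_n. *)
Definition nu : Type :=
  if pselect (finite_set [set: V]) then ('I_nu_fin : Type)
  else if pselect (infinite_set [set: F] /\
                   infinite_set (vdim (fullsubmod V))) then (nat : Type)
  else (k.-tuple F + unit)%type.

End Nu.

(* Main.v *)
Require Import Defs.
From HB Require Import structures.
From mathcomp Require Import fingroup pgroup separable closed_field zify.
From mathcomp Require Import all_boot all_order all_algebra finmap.
From mathcomp Require Import all_classical.

Set Implicit Arguments.
Unset Strict Implicit.
Unset Printing Implicit Defensive.

Import Order.TTheory Num.Theory GRing.Theory.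

Local Open Scope classical_set_scope.
Local Open Scope ring_scope.
Local Open Scope card_scope.

(**
The proof works with subspaces W such that some k vectors are independent
modulo W, a condition equivalent to codimension at least k (codim_geP). Covers
pull back along surjective linear maps (has_cover_pullback), and a space of
dimension at least n maps onto F^n (coord_map), so covers have to be built only
on spaces F^n. Four cases occur.

F and V finite, with q elements and dimension n = k + d. A subspace of
codimension at least k has at most q^d vectors, one of which is 0, so m of them
can cover V only if q^n - 1 <= m (q^d - 1) (cover_count). Counting lines shows
that this is the condition nu <= m (nu_fin_le). Conversely, let F^k be
identified with the field with q^k elements (finField_mul). For linear maps al,
be from V to F^k, the q^k subspaces al = a be cover all the vectors outside of
the kernel of be (spread_cover). If k <= d, then be may be taken onto F^k, and
its kernel is the last member of a cover by q^k + 1 subspaces. If d < k, then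
be may be taken with a kernel of dimension k, in which one looks for a cover by
d-dimensional subspaces: this is the same problem with k - d in place of k. The
number of subspaces N.+1 produced by this descent satisfies
N (q^d - 1) < q^n - 1 (finite_cover), hence is at most nu.

F finite, V infinite. The quotient F^(k + k) of V has a cover by q^k + 1
subspaces as above. Conversely, a finite cover restricts to a large enough
finite-dimensional subspace, where counting shows that it has more than q^k
members (finite_field_cover).

F infinite, V of finite dimension n. All the cardinals at stake are that of F,
because |X x X| = |X| for X infinite (card_square). The lines of F^(k + 1)
give a cover (lines_cover). Conversely, a proper subspace contains fewer than n
points of a moment curve, so that |F| <= |I x n| = |I| (moment_curve).

F infinite, V of infinite dimension. V is the union of an increasing sequence
of subspaces of infinite codimension (coordinate_cover), and the moment curve
shows that I cannot be finite (inf_dim_cover).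
*)

(** * Comparing cardinals *)

Lemma card_le_rel (T U : Type) (A : set T) (B : set U) (R : T -> U -> Prop) :
  (forall x, A x -> exists2 y, B y & R x y) ->
  (forall x x' y, A x -> A x' -> R x y -> R x' y -> x = x') -> A #<= B.
Proof.
move=> totR injR.
have /choice[f fR] (a : A) : exists b : B, R (val a) (val b).
  have [y By Ry] := totR _ (set_valP a).
  by exists (SigSub (mem_set By)).
apply/card_leP/injfunPex; exists f => // a a' _ _ faa'.
apply/val_inj/(injR _ _ (val (f a))) => //; try exact: set_valP.
by rewrite faa'.
Qed.

Lemma card_le_inj (T U : Type) (A : set T) (B : set U) (f : T -> U) :
  (forall x, A x -> B (f x)) ->
  (forall x x', A x -> A x' -> f x = f x' -> x = x') -> A #<= B.
Proof.
move=> fAB finj; apply: (card_le_rel (R := fun x y => f x = y)).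
  by move=> x Ax; exists (f x) => //; exact: fAB.
by move=> x x' y Ax Ax' <- /esym; exact: finj.
Qed.

Lemma card_le_exinj (T U : Type) (y0 : U) (A : set T) (B : set U) :
  A #<= B -> exists f : T -> U, (forall x, A x -> B (f x)) /\
    (forall x x', A x -> A x' -> f x = f x' -> x = x').
Proof.
move=> /card_leP[f].
exists (fun x => if pselect (A x) is left Ax then val (f (SigSub (mem_set Ax)))
                 else y0); split.
  by move=> x Ax; case: pselect => // Ax'; exact: set_valP.
move=> x x' Ax Ax'; case: pselect => // ax; case: pselect => // ax' /val_inj/inj.
by move=> /(_ (in_setT _) (in_setT _)) [].
Qed.

Lemma card_leTP (T U : Type) (B : set U) :
  [set: T] #<= B <-> exists f : T -> U, injective f /\ forall x, B (f x).
Proof.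
split; last by move=> [f [fi fB]]; apply: (card_le_inj (f := f)) => // x x' _ _ /fi.
move=> TB; have [[x0]|T0] := pselect (inhabited T); last first.
  by exists (fun x => False_rect _ (T0 (inhabits x))); split=> x; case: T0.
have [y0] : inhabited U.
  move: TB => /card_leP[f]; split; exact: (val (f (SigSub (mem_set (I : setT x0))))).
have [f [fB fi]] := card_le_exinj y0 TB.
by exists f; split=> [x x'|x]; [exact: fi | exact: fB].
Qed.

Lemma card_leTT (T U : Type) :
  [set: T] #<= [set: U] <-> exists f : T -> U, injective f.
Proof.
by rewrite card_leTP; split=> [[f []]|[f fi]]; exists f.
Qed.

(** The symmetric form makes a single statement of functionality and of
    injectivity. *)
Definition partial_inj (T U : Type) (G : set (T * U)) :=
  forall p q, G p -> G q -> p.1 = q.1 <-> p.2 = q.2.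

Lemma partial_inj_bigcup (T U : Type) (C : set (set (T * U))) :
  total_on C subset -> (forall G, C G -> partial_inj G) ->
  partial_inj (\bigcup_(G in C) G).
Proof.
move=> Ctot Cinj p q [G CG Gp] [H CH Hq].
by have [GH|HG] := Ctot _ _ CG CH; [apply: (Cinj H)|apply: (Cinj G)]; auto.
Qed.

(** Two cardinals are comparable: a maximal partial injection from A to B is
    total or onto, since otherwise it can be extended by one more pair. *)
Lemma card_le_total (T U : Type) (A : set T) (B : set U) : A #<= B \/ B #<= A.
Proof.
pose P := [set G : set (T * U) | partial_inj G /\
             forall p, G p -> A p.1 /\ B p.2].
have [C CP Ctot|G [[Ginj GAB] Gmax]] := @Zorn_bigcup _ P.
  split; first by apply: partial_inj_bigcup => // G /CP[].
  by move=> p [G /CP[_]]; exact.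
have [dA|/existsNP[a /not_implyP[Aa Ga]]] :=
    pselect (forall a, A a -> exists b, G (a, b)).
  left; apply: (card_le_rel (R := fun a b => G (a, b))).
    by move=> a /dA[b Gab]; exists b => //; have [] := GAB _ Gab.
  by move=> x x' y _ _ Gx Gx'; apply/(Ginj _ _ Gx Gx').
have [dB|/existsNP[b /not_implyP[Bb Gb]]] :=
    pselect (forall b, B b -> exists a, G (a, b)).
  right; apply: (card_le_rel (R := fun b a => G (a, b))).
    by move=> b /dB[a' Gab]; exists a' => //; have [] := GAB _ Gab.
  by move=> x x' y _ _ Gx Gx'; apply/(Ginj _ _ Gx Gx').
exfalso; apply: (Gmax (G `|` [set (a, b)])).
  split; first by move=> p; left.
  by move=> E; apply: Ga; exists b; apply: E; right.
split; last by move=> p [/GAB//|->].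
move=> [x y] [x' y'] /= [Gxy|[-> ->]] [Gxy'|[-> ->]] //.
- exact: (Ginj _ _ Gxy Gxy').
- by split=> E; exfalso; [apply: Ga; exists y; rewrite -E|
    apply: Gb; exists x; rewrite -E].
- by split=> E; exfalso; [apply: Ga; exists y'; rewrite E|
    apply: Gb; exists x'; rewrite E].
Qed.

Section Square.
Variable X : Type.
Implicit Types G : set ((X * X) * X).

Let field_of G : set X := [set x | exists y, G ((x, x), y)].

Let pairing G := [/\ partial_inj G,
  forall p, G p -> [/\ field_of G p.1.1, field_of G p.1.2 & field_of G p.2] &
  forall a b, field_of G a -> field_of G b -> exists y, G ((a, b), y)].

Lemma pairing_bigcup (C : set (set ((X * X) * X))) :
  total_on C subset -> (forall G, C G -> pairing G) ->
  pairing (\bigcup_(G in C) G).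
Proof.
move=> Ctot Cp; split.
- by apply: partial_inj_bigcup => // G /Cp[].
- move=> p [G CG Gp]; have [_ /(_ _ Gp)[[y1 ?] [y2 ?] [y3 ?]] _] := Cp _ CG.
  by split; [exists y1|exists y2|exists y3]; exists G.
- move=> a b [y [G CG Gy]] [z [H CH Hz]].
  have [K CK [Ka Kb]] : exists2 K, C K & K ((a, a), y) /\ K ((b, b), z).
    by have [GH|HG] := Ctot _ _ CG CH; [exists H|exists G]; auto.
  have [_ _ /(_ a b)[||w Kw]] := Cp _ CK; [by exists y|by exists z|].
  by exists w, K.
Qed.

(** Hessenberg's theorem. Zorn's lemma provides a maximal injection f from
    A x A to A, with A infinite. If the complement of A embeds in A, then X
    embeds in A x A, hence in A, and f gives the conclusion. If not, A has a
    copy C in its complement, and C has room for all the pairs of elements of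
    A and C that are not yet coded, so that f would not be maximal. *)
Lemma card_square : infinite_set [set: X] -> [set: X * X] #<= [set: X].
Proof.
move=> /infiniteP /card_leTT[h hinj].
have [c cinj] : exists c : nat * nat -> nat, injective c.
  by apply/card_leTT; have := card_nat2; rewrite card_eq_le => /andP[].
pose G0 : set ((X * X) * X) :=
  [set p | exists m n, p = ((h m, h n), h (c (m, n)))].
have G0field x : field_of G0 x -> exists m, x = h m.
  by move=> [y [m [n [-> _ _]]]]; exists m.
have fieldh m : field_of G0 (h m) by exists (h (c (m, m))), m, m.
have G0p : pairing G0.
  split.
  - move=> _ _ [m [n ->]] [m' [n' ->]] /=; split=> [[/hinj-> /hinj->//]|].
    by move=> /hinj /cinj[-> ->].
  - by move=> _ [m [n ->]] /=; split; exact: fieldh.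
  - by move=> a b /G0field[m ->] /G0field[n ->]; exists (h (c (m, n))), m, n.
have [C CP Ctot|G [Gp0 Gmax]] := @Zorn_bigcup _ [set G | pairing (G0 `|` G)].
  (* Adjoining G0 to the chain also settles the empty chain *)
  rewrite /=.
  have -> : G0 `|` \bigcup_(G in C) G =
      \bigcup_(G in [set H | H = G0 \/ exists2 G, C G & H = G0 `|` G]) G.
    apply/seteqP; split=> [p [G0p'|[G CG Gp]]|p [_ [->|[G CG ->]]]].
    - by exists G0 => //; left.
    - by exists (G0 `|` G); [right; exists G|right].
    - by left.
    - by move=> [?|?]; [left|right; exists G].
  apply: pairing_bigcup; last by move=> _ [->//|[G /CP ? ->]].
  move=> _ _ [->|[G CG ->]] [->|[H CH ->]].
  - by left.
  - by left; exact: subsetUl.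
  - by right; exact: subsetUl.
  - by have [GH|HG] := Ctot _ _ CG CH; [left|right]; exact: setUS.
have {Gp0 Gmax} [{}G [G0G [Ginj Gfield Gtot] Gmax]] :
    exists G, [/\ G0 `<=` G, pairing G &
      forall H, G `<=` H -> pairing H -> H `<=` G].
  exists (G0 `|` G); split=> [||H GH Hp]; [exact: subsetUl|by []|].
  apply: contrapT => nHG; apply: (Gmax H).
    split=> [|HG]; first by move=> p Gp; apply: GH; right.
    by apply: nHG => p Hp'; right; apply: HG.
  by have /setUidPr /= -> : G0 `<=` H by move=> p ?; apply: GH; left.
pose A := field_of G.
have Ah m : A (h m) by have [y Gy] := fieldh m; exists y; apply: G0G.
have /choice[f fG] : forall p : X * X, exists y, A p.1 -> A p.2 -> G (p, y).
  move=> [a b]; have [[Aa Ab]|nab] := pselect (A a /\ A b).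
    by have [y Gy] := Gtot a b Aa Ab; exists y.
  by exists a => /= Aa Ab; case: nab.
have fA a b : A a -> A b -> A (f (a, b)).
  by move=> Aa Ab; have [] := Gfield _ (fG (a, b) Aa Ab).
have finj a b a' b' : A a -> A b -> A a' -> A b' ->
    f (a, b) = f (a', b') -> a = a' /\ b = b'.
  move=> Aa Ab Aa' Ab' E.
  by have /(_ E)[] := proj2 (Ginj _ _ (fG (a, b) Aa Ab) (fG (a', b') Aa' Ab')).
have h01 : h 0%N <> h 1%N by move=> /hinj.
have [AcA|AAc] := card_le_total (~` A) A.
  have [j [jA jinj]] := card_le_exinj (h 0%N) AcA.
  have [g [gA ginj]] : exists g : X -> X, (forall x, A (g x)) /\ injective g.
    exists (fun x => if pselect (A x) is left _ then f (h 0%N, x)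
                     else f (h 1%N, j x)).
    split=> [x|x x']; first by case: pselect => [Ax|/jA jAx]; apply: fA.
    case: pselect => [Ax|Ax]; case: pselect => [Ax'|Ax'].
    - by move/finj => [||||_ ->].
    - by move/finj => [||||/h01 //] //; exact: jA.
    - by move/finj => [||||/esym/h01//] //; exact: jA.
    - by move/finj => [||||_ /jinj] //; [exact: jA|exact: jA|exact].
  apply/card_leTT; exists (fun p => f (g p.1, g p.2)) => -[a b] [a' b'] /=.
  by move=> /finj[] // /ginj -> /ginj ->.
exfalso.
have [j [jA jinj]] := card_le_exinj (h 0%N) AAc.
pose C := [set x | exists2 a, A a & x = j a].
have CnA x : C x -> ~ A x by move=> [a Aa ->]; exact: jA.
have /choice[u uP] : forall x, exists y,
    (A x -> y = x) /\ (C x -> A y /\ x = j y).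
  move=> x; have [Ax|nAx] := pselect (A x).
    by exists x; split=> // /CnA.
  have [[a Aa ->]|nCx] := pselect (C x); last by exists x.
  by exists a; split=> // /(jA _ Aa).
(* An element of A or C is coded by an element u x of A, with a tag in A. *)
pose tag x := if pselect (A x) then h 0%N else h 1%N.
have tagA x : A (tag x) by rewrite /tag; case: pselect => ?; apply: Ah.
pose D := A `|` C.
have uA x : D x -> A (u x).
  by case=> [Ax|Cx]; have [uPA uPC] := uP x; [rewrite uPA|have [] := uPC Cx].
have code_inj x y : D x -> D y -> tag x = tag y -> u x = u y -> x = y.
  rewrite /tag; case: pselect => [Ax|nAx]; case: pselect => [Ay|nAy] Dx Dy.
  - by rewrite (proj1 (uP x)) // (proj1 (uP y)).
  - by move=> /h01.
  - by move=> /esym/h01.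
  - case: Dx Dy => [//|Cx] [//|Cy] _ E.
    by rewrite (proj2 (proj2 (uP x) Cx)) E -(proj2 (proj2 (uP y) Cy)).
pose g p := j (f (f (tag p.1, tag p.2), f (u p.1, u p.2))).
have gC p : D p.1 -> D p.2 -> C (g p).
  by move=> D1 D2; exists (f (f (tag p.1, tag p.2), f (u p.1, u p.2)));
    rewrite ?inE //; apply: (fA); apply: (fA); auto.
have ginj p q : D p.1 -> D p.2 -> D q.1 -> D q.2 -> g p = g q -> p = q.
  case: p q => [x y] [x' y'] /= Dx Dy Dx' Dy' /jinj.
  have Ax := uA _ Dx; have Ay := uA _ Dy; have Ax' := uA _ Dx'.
  have Ay' := uA _ Dy'.
  move=> /= E; have {E} : f (f (tag x, tag y), f (u x, u y)) =
                 f (f (tag x', tag y'), f (u x', u y')).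
    by apply: E; apply: (fA); apply: fA.
  move=> /finj[]; [by apply: fA..|].
  move=> /finj[]// tx ty /finj[]// ux uy.
  by rewrite (code_inj x x') // (code_inj y y').
pose new := [set p : (X * X) * X | [/\ D p.1.1, D p.1.2,
               ~ (A p.1.1 /\ A p.1.2) & p.2 = g p.1]].
have Dfield x : D x <-> field_of (G `|` new) x.
  split=> [[[y Gy]|Cx]|[y [Gy|[]//]]]; first by exists y; left.
    by exists (g (x, x)); right; split=> //=; [right|right|case=> /(CnA _ Cx)].
  by left; exists y.
have newG : new `<=` G.
  suff HG : G `|` new `<=` G by move=> p ?; apply: HG; right.
  apply: Gmax; first by move=> ? ?; left.
  split.
  - have Gnew p q : G p -> new q -> p.1 = q.1 <-> p.2 = q.2.
      move=> Gp [D1 D2 nA E]; have [A1 A2 A3] := Gfield _ Gp.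
      split=> F; first by case: nA; rewrite -F.
      by case: (@CnA p.2) => //; rewrite F E; apply: gC.
    move=> p q [Gp|Np] [Gq|Nq]; [exact: Ginj|exact: Gnew| |].
      by have [E1 E2] := Gnew _ _ Gq Np; split=> /esym/[dup] ? ?;
        [rewrite E1|rewrite E2].
    case: Np Nq => D1 D2 _ -> [D3 D4 _ ->]; split=> [->//|]; exact: ginj.
  - move=> p [Gp|[D1 D2 _ E]].
      by have [[y ?] [z ?] [w ?]] := Gfield _ Gp; split;
        [exists y|exists z|exists w]; left.
    by split; apply/Dfield => //; rewrite E; right; apply: gC.
  - move=> a b /Dfield Da /Dfield Db.
    have [[Aa Ab]|nab] := pselect (A a /\ A b).
      by exists (f (a, b)); left; apply: (fG (a, b)).
    by exists (g (a, b)); right.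
have Cx : C (j (h 0%N)) by exists (h 0%N).
apply: (CnA _ Cx); exists (g (j (h 0%N), j (h 0%N))); apply: newG.
by split=> //=; [right|right|case=> /(CnA _ Cx)].
Qed.
End Square.

Lemma card_leIP (k : nat) (U : Type) (B : set U) :
  `I_k #<= B <-> exists f : 'I_k -> U, injective f /\ forall i, B (f i).
Proof. by rewrite -card_leTP (card_le_eql card_II). Qed.

Lemma card_eqI_enum (n : nat) (U : Type) (B : set U) :
  B #= `I_n -> exists2 f : 'I_n -> U, injective f & B = range f.
Proof.
rewrite card_eq_sym (card_eql card_II) => /card_eqP[f].
exists (fun i => val (f (SigSub (mem_set (I : setT i))))) => [i j|].
  by move=> /val_inj/inj; rewrite !inE => /(_ I I)[].
apply/seteqP; split=> [b Bb|_ [i _ <-]]; last exact: set_valP.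
have [i _ ib] : range f (SigSub (mem_set Bb)).
  by have := @surj _ _ _ _ f; apply.
exists (val i) => //; rewrite -[b]/(val (SigSub (mem_set Bb))) -ib.
by congr (val (f _)); apply: val_inj.
Qed.

Lemma card_eqI (n : nat) (U : Type) (B : set U) :
  `I_n #<= B -> ~ (`I_n.+1 #<= B) -> B #= `I_n.
Proof.
move=> nB n1B; have [[m Bm]|/infiniteP Binf] := pselect (finite_set B).
  rewrite (card_le_eqr Bm) card_le_II in nB.
  rewrite (card_le_eqr Bm) card_le_II in n1B.
  by have <- : m = n by apply/eqP; rewrite eqn_leq nB andbT leqNgt; apply/negP.
by case: n1B; apply: card_le_trans Binf; exact: card_leT.
Qed.

Lemma card_le_fin (T : finType) n : (#|T| <= n)%N -> [set: T] #<= [set: 'I_n].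
Proof.
move=> Tn; apply/card_leTT; exists (widen_ord Tn \o enum_rank) => x y E.
by apply/enum_rank_inj/val_inj; exact: (congr1 val E).
Qed.

Lemma card_fin_eq (T : finType) (U : Type) (g : T -> U) :
  injective g -> (forall y, exists x, g x = y) -> [set: U] #= `I_#|T|.
Proof.
move=> gi gs; have TU : [set: T] #<= [set: U] by apply/card_leTT; exists g.
have UT : [set: U] #<= [set: T].
  have /choice[h hK] := gs; apply/card_leTT; exists h => x y E.
  by rewrite -(hK x) E hK.
rewrite (card_eqr card_II); apply: Cantor_Bernstein.
  by apply: card_le_trans UT (card_le_fin _).
apply: card_le_trans TU; apply/card_leTT; exists enum_val; exact: enum_val_inj.
Qed.

Section SmallSets.
Variable X : Type.
Hypothesis Xinf : infinite_set [set: X].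

Lemma card_prod_le (A B : Type) :
  [set: A] #<= [set: X] -> [set: B] #<= [set: X] -> [set: A * B] #<= [set: X].
Proof.
move=> /card_leTT[f fi] /card_leTT[g gi].
apply: card_le_trans (card_square Xinf); apply/card_leTT.
by exists (fun p => (f p.1, g p.2)) => -[a b] [a' b'] [/fi -> /gi ->].
Qed.

Lemma card_fin_le n : [set: 'I_n] #<= [set: X].
Proof.
have /infiniteP Xn := Xinf; apply: card_le_trans Xn.
by apply/card_leTT; exists (@nat_of_ord n); exact: val_inj.
Qed.

(** Lists of a fixed length are coded by iterating an injection from X x X to
    X. The length has to be fixed, as the code of the empty list may also be
    the code of another list. *)
Lemma card_seq_le (A : Type) n (s : A -> seq X) : injective s ->
  (forall a, size (s a) = n) -> [set: A] #<= [set: X].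
Proof.
have /card_leTT[f fi] := card_square Xinf.
have [x0 _] := infinite_setN0 Xinf.
pose g := foldr (fun x y => f (x, y)) x0.
have gi u v : size u = size v -> g u = g v -> u = v.
  elim: u v => [|x u IH] [|y v] //= [uv] /fi[-> /IH->] //.
by move=> si sn; apply/card_leTT; exists (g \o s) => a b E;
  apply/si/gi; rewrite ?sn.
Qed.

Lemma card_sum_unit_le (A : Type) :
  [set: A] #<= [set: X] -> [set: A + unit] #<= [set: X].
Proof.
move=> /card_leTT[f fi]; apply: card_le_trans (card_square Xinf).
have /card_leTT[g gi] := card_fin_le 2.
apply/card_leTT; exists (fun u => match u with
  inl a => (g ord0, f a) | inr _ => (g ord_max, g ord0) end).
by move=> [a|[]] [b|[]] // [] => [/fi ->|/gi|/gi].
Qed.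
End SmallSets.

(** * Independent families and dimension *)

Section Families.
Variables (F : fieldType) (V : lmodType F).
Implicit Types (U B : set V) (W : submodClosed V).

Definition lin_comb n (v : 'I_n -> V) (c : 'I_n -> F) : V :=
  \sum_i c i *: v i.

Definition indep n (v : 'I_n -> V) :=
  forall c : 'I_n -> F, lin_comb v c = 0 -> forall i, c i = 0.

(** Bases are sets and their linear combinations are indexed by finite sets of
    vectors; this lemma serves to pass to families indexed by ordinals, to which
    matrices apply. *)
Lemma sum_fset_range n (v : 'I_n -> V) (s : {fset V}) (G : V -> V) :
  injective v -> [set` s] `<=` range v ->
  \sum_(x <- s) G x = \sum_(i | v i \in s) G (v i).
Proof.
move=> vi sv; rewrite -[RHS]big_filter -(big_map v xpredT G).
apply/perm_big/uniq_perm; first exact: fset_uniq.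
  by rewrite map_inj_uniq ?filter_uniq ?index_enum_uniq.
move=> x; apply/idP/mapP => [xs|[i]]; last by rewrite mem_filter => /andP[? _] ->.
by have [i _ ix] := sv x xs; exists i; rewrite // mem_filter ix xs mem_index_enum.
Qed.

Lemma range_fset n (v : 'I_n -> V) :
  exists2 s : {fset V}, range v = [set` s] & forall i, v i \in s.
Proof.
have /finite_fsetP[s sE] : finite_set (range v) by exact/finite_image/finite_finset.
by exists s => // i; have : [set` s] (v i) by rewrite -sE; exists i.
Qed.

Lemma lin_span_range n (v : 'I_n -> V) x : injective v ->
  lin_span (range v) x <-> exists c, x = lin_comb v c.
Proof.
move=> vi; split=> [[s [c [sv ->]]]|[c ->]].
  exists (fun i => if v i \in s then c (v i) else 0).
  rewrite (sum_fset_range _ vi sv) big_mkcond; apply: eq_bigr => i _.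
  by case: ifP; rewrite ?scale0r.
have [d dP] : exists d : V -> F, forall i, d (v i) = c i.
  have /choice[d dP] : forall x, exists a, forall i, v i = x -> a = c i.
    move=> y; have [[i <-]|ny] := pselect (exists i, v i = y).
      by exists (c i) => j /vi ->.
    by exists 0 => i vy; case: ny; exists i.
  by exists d => i; apply: dP.
have [s sE vs] := range_fset v.
exists s, d; split; first by rewrite -sE.
by rewrite (sum_fset_range _ vi) -?sE // [RHS]big_mkcond; apply: eq_bigr => i _;
  rewrite vs dP.
Qed.

Lemma lin_indep_range n (v : 'I_n -> V) :
  injective v -> lin_indep (range v) <-> indep v.
Proof.
move=> vi; split=> vI.
  move=> c c0 i.
  have [s sE vs] := range_fset v.
  have /choice[d dP] : forall x, exists a, forall i, v i = x -> a = c i.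
    move=> y; have [[j <-]|ny] := pselect (exists i, v i = y).
      by exists (c j) => l /vi ->.
    by exists 0 => j vy; case: ny; exists j.
  rewrite -(dP _ i erefl); apply: (vI s) => //; first by rewrite -sE.
  rewrite (sum_fset_range _ vi) -?sE // big_mkcond -[RHS]c0.
  by apply: eq_bigr => j _; rewrite vs (dP _ j).
move=> s c sv; rewrite (sum_fset_range _ vi sv) => s0 x xs.
have [i _ vx] := sv _ xs.
have := vI (fun i => if v i \in s then c (v i) else 0) _ i.
rewrite vx xs; apply; rewrite -[RHS]s0 big_mkcond; apply: eq_bigr => j _.
by case: ifP; rewrite ?scale0r.
Qed.

Lemma lin_indep_sub B B' : B' `<=` B -> lin_indep B -> lin_indep B'.
Proof. by move=> B'B BI s c sB'; apply: BI; apply: subset_trans B'B. Qed.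

(** Steinitz's exchange lemma, through ranks: the matrix of the coordinates of
    w in v has k independent rows and n columns. *)
Lemma indep_le_span k n (w : 'I_k -> V) (v : 'I_n -> V) :
  indep w -> (forall i, exists c, w i = lin_comb v c) -> (k <= n)%N.
Proof.
move=> wI /choice[A wA]; pose M := \matrix_(i, j) A i j.
suff /eqP <- : row_free M by exact: rank_leq_col.
apply: inj_row_free => u uM; apply/rowP => i; rewrite mxE.
apply: (wI (fun i => u 0 i)); rewrite /lin_comb.
under eq_bigr => l _ do rewrite wA scaler_sumr.
rewrite exchange_big big1 // => j _.
under eq_bigr do rewrite scalerA.
rewrite -scaler_suml; have /rowP/(_ j) := uM.
rewrite !mxE => E; under eq_bigr => l _ do
  [have -> : A l j = M l j by rewrite mxE]; by rewrite E scale0r.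
Qed.

(** Over a field, a bound on the dimension is a statement on finite
    independent families, whichever basis represents the dimension. *)
Lemma card_le_basis U B k : is_basis U B ->
  `I_k #<= B <-> exists2 v : 'I_k -> V, forall i, U (v i) & indep v.
Proof.
move=> [BU BI Bspan]; split=> [/card_leIP[v [vi vB]]|[v vU vI]].
  exists v; first by move=> i; apply: BU.
  by apply/(lin_indep_range vi)/(lin_indep_sub _ BI) => _ [i _ <-].
have [[n Bn]|/infiniteP Binf] := pselect (finite_set B); last first.
  by apply: card_le_trans Binf; exact: card_leT.
have [e ei Be] := card_eqI_enum Bn.
rewrite (card_le_eqr Bn) card_le_II; apply: (indep_le_span vI) => i.
by apply/(lin_span_range _ ei); rewrite -Be; apply: Bspan.
Qed.

Lemma vdim_eqP W n : vdim W #= `I_n <-> exists2 v : 'I_n -> V, indep v &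
  forall x, x \in W <-> exists c, x = lin_comb v c.
Proof.
have [BU BI Bspan] := vdimP W; split=> [Bn|[v vI vW]].
  have [e ei Be] := card_eqI_enum Bn; exists e.
    by apply/(lin_indep_range ei); rewrite -Be.
  move=> x; rewrite -(lin_span_range _ ei) -Be; split; first exact: Bspan.
  move=> [s [c [sB ->]]]; rewrite big_seq; apply: rpred_sum => y ys.
  by apply: rpredZ; apply: BU; apply: sB.
apply: card_eqI.
  apply/(card_le_basis _ (vdimP W)); exists v => // i; apply/vW.
  exists (fun j => (j == i)%:R); rewrite /lin_comb (bigD1 i)//= eqxx scale1r.
  by rewrite big1 ?addr0 // => j /negPf->; rewrite scale0r.
move=> /(card_le_basis _ (vdimP W))[w wW wI].
by have := indep_le_span wI (fun i => proj1 (vW _) (wW i)); rewrite ltnn.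
Qed.

Definition codim_ge W k := exists v : 'I_k -> V,
  forall c : 'I_k -> F, lin_comb v c \in W -> forall i, c i = 0.

End Families.

Lemma linear_lin_comb (F : fieldType) (U V : lmodType F) (f : {linear U -> V})
    n (v : 'I_n -> U) c : f (lin_comb v c) = lin_comb (f \o v) c.
Proof. by rewrite /lin_comb linear_sum; apply: eq_bigr => i _; rewrite linearZ. Qed.

Lemma eq_lin_comb (F : fieldType) (V : lmodType F) n (v w : 'I_n -> V) c :
  v =1 w -> lin_comb v c = lin_comb w c.
Proof. by move=> vw; apply: eq_bigr => i _; rewrite vw. Qed.

Lemma lin_combD (F : fieldType) (V : lmodType F) n (v : 'I_n -> V) a (c d : 'rV[F]_n) :
  lin_comb v ((a *: c + d) 0) = a *: lin_comb v (c 0) + lin_comb v (d 0).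
Proof.
rewrite /lin_comb scaler_sumr -big_split; apply: eq_bigr => i _.
by rewrite !mxE scalerDl scalerA.
Qed.

Lemma lin_comb_row (F : fieldType) (V : lmodType F) n (v : 'I_n -> V) c :
  lin_comb v ((\row_i c i) 0) = lin_comb v c.
Proof. by apply: eq_bigr => i _; rewrite mxE. Qed.

Lemma lin_comb_inj (F : fieldType) (V : lmodType F) n (v : 'I_n -> V) :
  indep v -> injective (fun c : 'rV[F]_n => lin_comb v (c 0)).
Proof.
move=> vI c d E; apply/rowP => i; apply/eqP; rewrite -subr_eq0; apply/eqP.
have := vI (fun i => (-1 *: d + c) 0 i); rewrite lin_combD E scaleN1r addNr.
by move=> /(_ erefl i); rewrite !mxE mulN1r addrC.
Qed.

(** The codimension is at least k when some k vectors are independent modulo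
    W, which no longer mentions the quotient. *)
Lemma codim_geP (F : fieldType) (V : lmodType F) (W : submodClosed V) k :
  `I_k #<= codim W <-> codim_ge W k.
Proof.
have pi00 : (\pi_(lquot W) 0 = 0)%qT.
  by apply: (addrI (\pi_(lquot W) 0)%qT); rewrite -pi_lquotD !addr0.
have pi_sum v (c : 'I_k -> F) : (\pi_(lquot W) (lin_comb v c) =
    lin_comb (fun i => \pi_(lquot W) (v i)) c)%qT.
  rewrite /lin_comb; elim/big_rec2: _ => [|i x y _ <-].
    exact: pi00.
  by rewrite pi_lquotD pi_lquotZ.
have pi0 x : (\pi_(lquot W) x = 0)%qT <-> x \in W.
  by rewrite -pi00 pi_lquot_eq subr0.
rewrite (card_le_basis _ (vdimP _)); split=> [[v _ vI]|[v vW]].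
  exists (fun i => repr (v i)) => c /pi0; rewrite pi_sum => cW; apply: vI.
  by rewrite -[RHS]cW; apply: eq_bigr => i _; rewrite reprK.
exists (fun i => \pi_(lquot W) (v i))%qT => // c.
by rewrite -pi_sum => /pi0/vW.
Qed.

(** * Coordinates with respect to a basis *)

Lemma linear_pack (F : fieldType) (U V : lmodType F) (f : U -> V) :
  linear f -> exists g : {linear U -> V}, forall x, g x = f x.
Proof.
move=> flin.
pose g : {linear U -> V} := HB.pack f (GRing.isLinear.Build _ _ _ _ _ flin).
by exists g.
Qed.

Section Coordinates.
Variables (F : fieldType) (V : lmodType F).
Implicit Types (B : set V) (s : {fset V}).

Let ext s (c : V -> F) v := if v \in s then c v else 0.

Lemma sum_ext s (t : {fset V}) c : (s `<=` t)%fset ->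
  \sum_(v <- s) c v *: v = \sum_(v <- t) ext s c v *: v.
Proof.
move=> st; rewrite -(big_fset_incl _ st) => [|v _ /negPf vs].
  by apply: eq_big_seq => v vs; rewrite /ext vs.
by rewrite /ext vs scale0r.
Qed.

(** The coordinates of x are read on a chosen expression of x; any other
    expression gives the same ones because both can be compared over the union
    of their supports. *)
Lemma basis_coord B : is_basis setT B -> exists co : V -> V -> F,
  forall s c b, [set` s] `<=` B ->
    co (\sum_(v <- s) c v *: v) b = if b \in s then c b else 0.
Proof.
move=> [_ BI Bspan].
have /choice[S SP] : forall x, exists p : {fset V} * (V -> F),
    [set` p.1] `<=` B /\ x = \sum_(v <- p.1) p.2 v *: v.
  by move=> x; have [s [c ?]] := Bspan x I; exists (s, c).
exists (fun x => ext (S x).1 (S x).2) => s c b sB.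
set x := \sum_(v <- s) _; have [tB xt] := SP x.
set t := (S x).1 in tB xt *; set d := (S x).2 in xt *.
rewrite -[RHS]/(ext s c b); apply/eqP; rewrite -subr_eq0; apply/eqP.
have [|/norP[bs bt]] := boolP ((b \in s) || (b \in t)); last first.
  by rewrite /ext (negPf bs) (negPf bt) subrr.
rewrite -in_fsetU; move: b.
apply: (BI (s `|` t)%fset (fun v => ext t d v - ext s c v)).
  by move=> v /=; rewrite in_fsetU => /orP[/sB|/tB].
under eq_bigr do rewrite scalerBl.
by rewrite sumrB -!sum_ext ?fsubsetUl ?fsubsetUr // -xt subrr.
Qed.

Lemma coord_family B (T : Type) (e : T -> V) :
  is_basis setT B -> injective e -> (forall t, B (e t)) ->
  exists l : T -> V -> F,
    [/\ forall t a x y, l t (a *: x + y) = a * l t x + l t y,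
        forall t t', l t (e t') = `[< t = t' >]%:R &
        forall x, finite_set [set t | l t x <> 0]].
Proof.
move=> Bb ei eB; have [co coE] := basis_coord Bb; have [_ BI Bspan] := Bb.
exists (fun t x => co x (e t)); split=> [t a x y|t t'|x].
- have [s [c [sB ->]]] := Bspan x I; have [s' [c' [sB' ->]]] := Bspan y I.
  have sub1 : (s `<=` s `|` s')%fset by exact: fsubsetUl.
  have sub2 : (s' `<=` s `|` s')%fset by exact: fsubsetUr.
  have UB : [set` (s `|` s')%fset] `<=` B.
    by move=> v /=; rewrite in_fsetU => /orP[/sB|/sB'].
  rewrite (sum_ext _ sub1) (sum_ext _ sub2) scaler_sumr -big_split /=.
  under eq_bigr do rewrite scalerA -scalerDl.
  by rewrite (coE _ (fun v => a * ext s c v + ext s' c' v)) // !coE //; case: ifP;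
    rewrite ?mulr0 ?addr0.
- have := coE [fset e t']%fset (fun=> 1) (e t).
  rewrite big_seq_fset1 scale1r in_fset1 => ->; last first.
    by move=> v /=; rewrite in_fset1 => /eqP->.
  have [/ei->|ne] := eqVneq (e t) (e t'); first by rewrite asboolT.
  by rewrite asboolF // => tt'; move: ne; rewrite tt' eqxx.
- have [s [c [sB ->]]] := Bspan x I.
  apply: (@sub_finite_set _ _ (e @^-1` [set` s])).
    by move=> t /=; rewrite coE //; case: ifP.
  by apply: finite_preimage => // t t' _ _ /ei.
Qed.

(** Sending a vector to its coordinates along k elements of a basis shows that
    a space of dimension at least k maps onto F^k. No quotient has to be chosen
    in order to reduce a space to a finite-dimensional one. *)
Lemma coord_map k : `I_k #<= vdim (fullsubmod V) ->
  exists f : {linear V -> 'rV[F]_k}, forall y, exists x, f x = y.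
Proof.
have fullE : [set` fullsubmod V] = [set: V] by apply/seteqP.
have Bb := vdimP (fullsubmod V); rewrite fullE in Bb.
move=> /card_leIP[e [ei eB]]; have [l [lin le _]] := coord_family Bb ei eB.
have flin : linear (fun x => \row_i l i x : 'rV[F]_k).
  by move=> a x y; apply/rowP => i; rewrite !mxE lin.
have [f fE] := linear_pack flin.
exists f => y; exists (lin_comb e (fun i => y 0 i)).
rewrite /lin_comb linear_sum; apply/rowP => j; rewrite summxE (bigD1 j) //=.
rewrite linearZ !mxE fE mxE le asboolT // mulr1 big1 ?addr0 // => i ij.
by rewrite linearZ !mxE fE mxE le asboolF ?mulr0 // => ji; rewrite ji eqxx in ij.
Qed.

End Coordinates.

(** * Covers by subspaces of codimension at least k *)

Section Covers.
Variables (F : fieldType) (k : nat).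

Definition is_submod (V : lmodType F) (A : set V) :=
  A 0 /\ forall a x y, A x -> A y -> A (a *: x + y).

Section Submod.
Variables (V : lmodType F) (A : set V) (hA : is_submod A).

Definition submod_pred of is_submod A : {pred V} := fun x => `[< A x >].

Fact submod_pred_closed : subsemimod_closed (submod_pred hA).
Proof.
have [A0 AD] := hA; split; first split.
- by apply/asboolP.
- by move=> x y /asboolP Ax /asboolP Ay; apply/asboolP; rewrite -[x]scale1r; auto.
- by move=> a x /asboolP Ax; apply/asboolP; rewrite -[_ *: _]addr0; auto.
Qed.

HB.instance Definition _ :=
  GRing.isSubmodClosed.Build F V (submod_pred hA) submod_pred_closed.

Lemma submod_of_set : exists W : submodClosed V, forall x, x \in W <-> A x.
Proof. by exists (submod_pred hA : submodClosed V) => x; split=> /asboolP. Qed.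
End Submod.

Lemma span_submod (V : lmodType F) n (v : 'I_n -> V) :
  exists W : submodClosed V, forall x, x \in W <-> exists c, x = lin_comb v c.
Proof.
apply: submod_of_set; split.
  by exists (fun=> 0); rewrite /lin_comb big1 // => i _; rewrite scale0r.
move=> a x y [c ->] [d ->].
exists ((a *: (\row_i c i) + \row_i d i) 0).
by rewrite lin_combD !lin_comb_row.
Qed.

Lemma line_submod (V : lmodType F) (v : V) :
  exists W : submodClosed V, forall x, x \in W <-> exists a : F, x = a *: v.
Proof.
have [W WE] := span_submod (fun _ : 'I_1 => v); exists W => x; rewrite WE.
split=> [[c ->]|[a ->]]; first by exists (c ord0); rewrite /lin_comb big_ord1.
by exists (fun=> a); rewrite /lin_comb big_ord1.
Qed.

Definition has_cover (V : lmodType F) (I : Type) :=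
  exists W : I -> submodClosed V,
    (forall i, codim_ge (W i) k) /\ forall x, exists i, x \in W i.

(** A subspace of codimension at least 1 is proper. *)
Lemma has_coverP (V : lmodType F) (I : Type) : (0 < k)%N ->
  (exists W : I -> submodClosed V,
     [/\ forall i, [set` W i] <> [set: V],
         forall i, `I_k #<= codim (W i) &
         [set: V] = \bigcup_i [set` W i]]) <-> has_cover V I.
Proof.
move=> k0; split=> [[W [_ Wk Wcov]]|[W [Wk Wcov]]]; exists W; split.
- by move=> i; apply/codim_geP.
- by move=> x; have : [set: V] x by []; rewrite Wcov => -[i _ ?]; exists i.
- move=> i WT; have [v vW] := Wk i.
  have : lin_comb v (fun=> 1) \in W i.
    by have : [set: V] (lin_comb v (fun=> 1)) by []; rewrite -WT.
  by move=> /vW/(_ (Ordinal k0))/eqP; rewrite oner_eq0.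
- by move=> i; apply/codim_geP.
- by apply/seteqP; split=> // x _; have [i ?] := Wcov x; exists i.
Qed.

(** Preimages of the subspaces of a cover keep a codimension of at least k as
    soon as the k vectors that witness it come from the source of f. The map
    f may be far from surjective: this allows restrictions to subspaces. *)
Lemma has_cover_preimage (U V : lmodType F) (I : Type) (f : {linear U -> V})
    (W : I -> submodClosed V) :
  (forall i, exists u : 'I_k -> U,
     forall c, lin_comb (f \o u) c \in W i -> forall j, c j = 0) ->
  (forall x, exists i, x \in W i) -> has_cover U I.
Proof.
move=> Wk Wcov; have /choice[W' W'E] : forall i, exists W' : submodClosed U,
    forall x, x \in W' <-> f x \in W i.
  move=> i; apply: submod_of_set; split; first by rewrite /= linear0 rpred0.
  by move=> a x y /= Wx Wy; rewrite linearP rpredD ?rpredZ.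
exists W'; split=> [i|x]; last by have [i ?] := Wcov (f x); exists i; apply/W'E.
have [u uW] := Wk i; exists u => c /W'E; rewrite linear_lin_comb; exact: uW.
Qed.

Lemma has_cover_pullback (U V : lmodType F) (I : Type) (f : {linear U -> V}) :
  (forall y, exists x, f x = y) -> has_cover V I -> has_cover U I.
Proof.
move=> /choice[g gK] [W [Wk Wcov]].
apply: (has_cover_preimage (f := f)) Wcov => i; have [v vW] := Wk i.
exists (g \o v) => c; rewrite (eq_lin_comb (w := v)); first exact: vW.
by move=> j; exact: gK.
Qed.

Lemma has_cover_reindex (V : lmodType F) (I J : Type) (g : I -> J) :
  (forall j, exists i, g i = j) -> has_cover V J -> has_cover V I.
Proof.
move=> gsurj [W [Wk Wcov]]; exists (W \o g); split=> [i|x]; first exact: Wk.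
by have [j xj] := Wcov x; have [i gi] := gsurj j; exists i; rewrite /= gi.
Qed.

(** The injection from J to I has a left inverse, because J is inhabited: some
    member of the cover contains 0. Repetitions are allowed in a family. *)
Lemma has_cover_le (V : lmodType F) (I J : Type) :
  [set: J] #<= [set: I] -> has_cover V J -> has_cover V I.
Proof.
move=> /card_leTT[h hi] cJ.
have [j0] : inhabited J by have [W [_ /(_ 0)[j _]]] := cJ.
have /choice[g gE] : forall i, exists j, forall j', h j' = i -> j' = j.
  move=> i; have [[j <-]|ni] := pselect (exists j, h j = i).
    by exists j => j' /hi.
  by exists j0 => j' ji; case: ni; exists j'.
by apply: (has_cover_reindex (g := g)) cJ => j; exists (h j); rewrite -(gE _ j).
Qed.
End Covers.

(** * A multiplication without zero divisors on F^e, for F finite *)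

(** Lemmas about finFieldType apply to a field whose finiteness is only a
    proposition. The record of structures on F is opened so that the new finite
    field has F itself, and not just a copy of F, as its underlying field. *)
Lemma finField_pack (F : fieldType) : finite_set [set: F] ->
  exists Ff : finFieldType, F = Ff :> fieldType.
Proof.
move=> /finite_seqP[s0 sE]; pose s := undup s0.
have sP : Finite.axiom s.
  move=> x; rewrite count_uniq_mem ?undup_uniq // mem_undup.
  suff -> : x \in s0 by [].
  by have : [set: F] x by []; rewrite sE.
have sK : pcancel (fun x : F => index x s) (fun n => nth None (map some s) n).
  move=> x; have xs : x \in s by have := sP x; rewrite -has_pred1 has_count => ->.
  by rewrite (nth_map x) ?index_mem // nth_index.
move: s sP sK => {s0 sE} s sP sK.
destruct F as [T c]; destruct c.
set F := GRing.Field.Pack _ in sP sK *.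
pose Ff : finFieldType := HB.pack T (GRing.Field.on F)
  (isCountable.Build F sK) (isFinite.Build F sP).
by exists Ff.
Qed.

Section FieldMultiplication.
Variable F : finFieldType.

Lemma finField_gt1 : (1 < #|F|)%N.
Proof. by rewrite (cardD1 0) (cardD1 1) !inE oner_eq0. Qed.

(** Multiplication by x permutes the nonzero elements, hence preserves their
    product. *)
Lemma finField_expf (x : F) : x ^+ #|F| = x.
Proof.
have [->|x0] := eqVneq x 0; first by rewrite expr0n gtn_eqF // ltnW ?finField_gt1.
have P0 : \prod_(y : F | y != 0) y != 0 by apply/prodf_neq0.
have : \prod_(y : F | y != 0) y = x ^+ #|F|.-1 * \prod_(y : F | y != 0) y.
  rewrite [LHS](reindex (fun y => x * y)) /=; last first.
    by exists (fun y => x^-1 * y) => y _; rewrite mulrA ?mulVf ?mulfV ?mul1r.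
  rewrite (eq_bigl (fun y => y != 0)) => [|y]; last first.
    by rewrite mulf_eq0 (negPf x0).
  rewrite big_split /= prodr_const; congr (_ ^+ _ * _).
  by rewrite -(cardC1 (0 : F)); apply: eq_card.
rewrite -{1}[\prod_(_ | _) _]mul1r => /(mulIf P0) E.
have q0 := ltnW finField_gt1.
by rewrite -(prednK q0) exprS -E mulr1.
Qed.

(** By Cauchy's theorem, a prime divisor r of the order of F is the additive
    order of some element x, and then r x = 0 makes r the characteristic. *)
Lemma finField_pnat : [pchar F].-nat #|F|.
Proof.
have q0 := ltnW finField_gt1.
apply/pnatP => // r r_pr; rewrite -cardsT => /(Cauchy r_pr)[x _ xr].
have xr0 : x * r%:R = 0 by rewrite mulr_natr -FinRing.zmodXgE -xr expg_order.
rewrite inE r_pr /=; have /orP[/eqP x0|//] : (x == 0) || (r%:R == 0 :> F).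
  by rewrite -mulf_eq0 xr0.
by move: xr r_pr; rewrite x0 (@order1 F) => <-.
Qed.

Section ScalarExtension.
Variables (K : fieldType) (f : {rmorphism F -> K}).

(** The field K, seen as a vector space over F through f *)
Definition restr_scalars of {rmorphism F -> K} : Type := K.
HB.instance Definition _ := GRing.Field.on (restr_scalars f).

Fact restr_scaleA a b (x : restr_scalars f) : f a * (f b * x) = f (a * b) * x.
Proof. by rewrite rmorphM mulrA. Qed.
Fact restr_scale1 (x : restr_scalars f) : f 1 * x = x.
Proof. by rewrite rmorph1 mul1r. Qed.
Fact restr_scaleDr a (x y : restr_scalars f) : f a * (x + y) = f a * x + f a * y.
Proof. exact: mulrDr. Qed.
Fact restr_scaleDl (x : restr_scalars f) a b : f (a + b) * x = f a * x + f b * x.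
Proof. by rewrite rmorphD mulrDl. Qed.
HB.instance Definition _ := GRing.Zmodule_isLmodule.Build F (restr_scalars f)
  restr_scaleA restr_scale1 restr_scaleDr restr_scaleDl.
End ScalarExtension.

(** This is the multiplication of the extension of F of degree e: inside the
    algebraic closure of F, the roots of X^m - X with m = #|F| ^ e form a ring
    and an F-subspace with m elements, hence of dimension e. In a basis of it,
    multiplication by b != 0 is injective, and so surjective by finiteness. *)
Lemma finField_mul (e : nat) : (0 < e)%N ->
  exists m : 'rV[F]_e -> {linear 'rV[F]_e -> 'rV[F]_e},
    forall b, b != 0 -> forall y, exists a, m a b = y.
Proof.
move=> e0; pose m := (#|F| ^ e)%N.
have q1 := finField_gt1.
have m1 : (1 < m)%N by rewrite -[1%N](expn0 #|F|) ltn_exp2l.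
have [Kc [f0 _]] := @countable_algebraic_closure F.
pose K := restr_scalars (f0 : {rmorphism F -> Kc}).
have [zs Dzs] := closed_field_poly_normal ('X^m - 'X : {poly Kc}).
have sz : size ('X^m - 'X : {poly Kc}) = m.+1.
  by rewrite size_polyDl size_polyXn // size_polyN size_polyX.
have lc : lead_coef ('X^m - 'X : {poly Kc}) = 1.
  by rewrite lead_coefDl ?lead_coefXn // size_polyXn size_polyN size_polyX.
rewrite lc scale1r in Dzs.
have mp : [pchar Kc].-nat m.
  rewrite (eq_pnat _ (fmorph_pchar f0)) pnatX.
  by rewrite finField_pnat.
have m0 : m%:R = 0 :> Kc.
  have [r r_pr rm] := pdivP m1.
  have rK : r \in [pchar Kc] by apply: (pnatPpi mp); rewrite mem_primes r_pr rm ltnW.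
  by apply/eqP; rewrite -(dvdn_pcharf rK).
(* The roots are simple, as m = 0 in K makes -1 the derivative of X^m - X. *)
have zsU : uniq zs.
  rewrite -separable_prod_XsubC -Dzs unlock derivB derivXn derivX.
  rewrite -mulr_natr -polyC_natr m0 polyC0 mulr0 sub0r.
  by rewrite -(scaleN1r 1) coprimepZr ?oppr_eq0 ?oner_eq0 // coprimep1.
have zss : size zs = m.
  by apply: succn_inj; rewrite -(size_prod_XsubC _ id) -Dzs sz.
have zsP x : (x \in zs) = (x ^+ m == x).
  by rewrite -root_prod_XsubC -Dzs /root !hornerE subr_eq0.
have zs_sub : is_submod [set x : K | x \in zs].
  split=> [|a x y] /=; first by rewrite (zsP 0) expr0n gtn_eqF // ltnW.
  rewrite !zsP => /eqP xm /eqP ym; rewrite exprDn_pchar // exprMn xm ym -rmorphXn.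
  suff -> : a ^+ m = a by [].
  rewrite /m; elim: e {e0 m m1 sz lc mp m0 zss zsP Dzs xm ym} => // e IH.
  by rewrite expnSr exprM IH finField_expf.
have [W WE] := submod_of_set zs_sub.
have [n Wn] : exists n, vdim W #= `I_n.
  apply: (@sub_finite_set _ _ [set` zs]); last exact: finite_seq.
  by have [BW _ _] := vdimP W; move=> x /BW /WE.
have [v vI vW] := (vdim_eqP W n).1 Wn.
have toL_inj := lin_comb_inj vI.
have ne : n = e.
  have : size zs = #|{: 'rV[F]_n}|.
    rewrite cardE -(size_map (fun c : 'rV[F]_n => lin_comb v (c 0) : Kc)).
    apply/perm_size/uniq_perm => [//||x]; first by
      rewrite (map_inj_uniq toL_inj) enum_uniq.
    apply/idP/mapP => [/WE/vW[c ->]|[c _ ->]]; last by apply/WE/vW; exists (c 0).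
    by exists (\row_i c i); rewrite ?mem_enum ?lin_comb_row.
  by rewrite zss card_mx mul1n => /eqP; rewrite eqn_exp2l // => /eqP.
subst n.
have /choice[m2 m2E] : forall p : 'rV[F]_e * 'rV[F]_e, exists c : 'rV[F]_e,
    lin_comb v (c 0) = lin_comb v (p.1 0) * lin_comb v (p.2 0).
  move=> [a b]; have zM x y : x \in zs -> y \in zs -> x * y \in zs.
    by rewrite !zsP exprMn => /eqP-> /eqP->.
  have /WE/vW[c cE] : (lin_comb v (a 0) * lin_comb v (b 0) : Kc) \in zs.
    by apply: zM; apply/WE/vW; [exists (a 0)|exists (b 0)].
  by exists (\row_i c i); rewrite /= cE lin_comb_row.
have m_lin a : linear (fun b => m2 (a, b)).
  move=> c x y; apply: toL_inj; rewrite m2E /= !lin_combD !m2E /= mulrDr.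
  by congr (_ + _); rewrite -[LHS]/(_ * (_ * _)) mulrCA.
have /choice[m' m'E] := fun a => linear_pack (m_lin a).
exists m' => b b0 y.
have tb0 : lin_comb v (b 0) != 0.
  apply: contra b0 => /eqP tb; apply/eqP/rowP => i; rewrite mxE.
  exact: vI tb i.
have m_inj : injective (fun a => m2 (a, b)).
  move=> a a' /(congr1 (fun c : 'rV[F]_e => lin_comb v (c 0))).
  by rewrite !m2E => /(mulIf tb0)/toL_inj.
by exists (invF m_inj y); rewrite m'E (f_invF m_inj y).
Qed.
End FieldMultiplication.

(** * Construction of covers *)

Lemma lin_comb_delta (F : fieldType) n (c : 'I_n -> F) :
  lin_comb (fun i => delta_mx 0 i : 'rV[F]_n) c = \row_i c i.
Proof.
rewrite [RHS]row_sum_delta; apply: eq_bigr => i _.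
by rewrite mxE.
Qed.

(** The key step. For a in F^k, the graph al x = a * be x is a subspace of
    codimension k. Outside of the kernel of be, every x lies on some graph,
    since a can be taken to be the quotient of al x by be x. So only the kernel
    of be remains to be covered. *)
Lemma spread_cover (F : fieldType) (V : lmodType F) (k : nat) (J : Type)
    (m : 'rV[F]_k -> {linear 'rV[F]_k -> 'rV[F]_k})
    (al be : {linear V -> 'rV[F]_k}) (W : J -> submodClosed V) :
  (forall b, b != 0 -> forall y, exists a, m a b = y) ->
  (forall y, exists2 x, be x = 0 & al x = y) ->
  (forall j, codim_ge (W j) k) -> (forall x, be x = 0 -> exists j, x \in W j) ->
  has_cover k V ('rV[F]_k + J)%type.
Proof.
move=> mP abP Wk Wcov.
have /choice[G GE] : forall a, exists G : submodClosed V,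
    forall x, x \in G <-> al x = m a (be x).
  move=> a; apply: submod_of_set; split; first by rewrite /= !linear0.
  by move=> b x y /= xG yG; rewrite !linearP xG yG.
exists (fun i => match i with inl a => G a | inr j => W j end).
split=> [[a|j]|x]; last 2 first.
- exact: Wk.
- have [/Wcov[j ?]|b0] := eqVneq (be x) 0; first by exists (inr j).
  by have [a ax] := mP _ b0 (al x); exists (inl a); apply/GE.
have /choice[v vP] : forall i : 'I_k, exists x, be x = 0 /\ al x = delta_mx 0 i.
  by move=> i; have [x ? ?] := abP (delta_mx 0 i); exists x.
exists v => c /GE; rewrite (linear_lin_comb al) (linear_lin_comb be).
rewrite (eq_lin_comb (v := be \o v) (w := fun=> 0) _ (fun i => (vP i).1)).
rewrite (eq_lin_comb (v := al \o v) _ (fun i => (vP i).2)) lin_comb_delta.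
rewrite [in RHS]/lin_comb [in RHS]big1 => [|i _]; last by rewrite scaler0.
by rewrite linear0 => /rowP E i; have := E i; rewrite !mxE.
Qed.

(** When k <= d, be can be chosen onto F^k; its kernel has codimension k and
    completes the cover. *)
Lemma spread_base (F : finFieldType) (k d : nat) : (0 < k <= d)%N ->
  has_cover k 'rV[F]_(k + d) ('rV[F]_k + unit)%type.
Proof.
move=> /andP[k0 kd]; have [m mP] := finField_mul F k0.
(* The matrix pid keeps the first k of the d coordinates. *)
pose pid : 'M[F]_(d, k) := pid_mx k.
have pidK : pid_mx k *m pid = 1%:M by rewrite pid_mx_id // pid_mx_1.
have [be beE] : exists be : {linear 'rV[F]_(k + d) -> 'rV[F]_k},
    forall x, be x = rsubmx x *m pid by exists (mulmxr pid \o rsubmx).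
have bek y : be (row_mx 0 (y *m pid_mx k)) = y.
  by rewrite beE row_mxKr -mulmxA pidK mulmx1.
have [W WE] : exists W : submodClosed 'rV[F]_(k + d), forall x, x \in W <-> be x = 0.
  apply: submod_of_set; split; first by rewrite /= linear0.
  by move=> a x y /= xG yG; rewrite linearP xG yG scaler0 addr0.
apply: (@spread_cover _ _ _ _ m lsubmx be (fun=> W)) => // [y|_|x /WE].
- by exists (row_mx y 0); [rewrite beE row_mxKr mul0mx|exact: row_mxKl].
- exists (fun i => row_mx 0 (delta_mx 0 i *m pid_mx k)) => c /WE.
  rewrite linear_lin_comb (eq_lin_comb (w := fun i => delta_mx 0 i)) => [|i].
    by rewrite lin_comb_delta => /rowP E i; have := E i; rewrite !mxE.
  by rewrite [LHS]bek.
- by exists tt.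
Qed.

(** When the last d coordinates are fewer than the first ones, be can only be
    injective on them, and its kernel is the space of the first coordinates: a
    cover of that smaller space, by subspaces of the same dimension, completes
    the one given by the graphs. *)
Lemma spread_rec (F : finFieldType) (k d : nat) (J : Type) : (0 < d)%N ->
  has_cover k 'rV[F]_(k + d) J ->
  has_cover (k + d) 'rV[F]_(k + d + d) ('rV[F]_(k + d) + J)%type.
Proof.
move=> d0 [W [Wk Wcov]].
have [m mP] : exists m :
    'rV[F]_(k + d) -> {linear 'rV[F]_(k + d) -> 'rV[F]_(k + d)}, forall b, b != 0 -> forall y, exists a, m a b = y.
  by apply: finField_mul; rewrite addn_gt0 d0 orbT.
have [be beE] : exists be : {linear 'rV[F]_(k + d + d) -> 'rV[F]_(k + d)},
    forall x, be x = rsubmx x *m pid_mx d by exists (mulmxr (pid_mx d) \o rsubmx).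
have be0 x : be x = 0 -> rsubmx x = 0.
  move=> /(congr1 (mulmxr (pid_mx d : 'M[F]_(k + d, d)))) /=.
  by rewrite beE mul0mx -mulmxA pid_mx_id ?leq_addl // pid_mx_1 mulmx1.
have /choice[W' W'E] : forall j, exists W' : submodClosed 'rV[F]_(k + d + d),
    forall x, x \in W' <-> rsubmx x = 0 /\ lsubmx x \in W j.
  move=> j; apply: submod_of_set; split; first by rewrite /= !linear0 rpred0.
  move=> a x y /= [x0 xG] [y0 yG]; rewrite !linearP /= x0 y0 scaler0 addr0.
  by rewrite rpredD ?rpredZ.
apply: (@spread_cover _ _ _ _ m lsubmx be W') => // [y|j|x /be0 x0].
- by exists (row_mx y 0); [rewrite beE row_mxKr mul0mx|exact: row_mxKl].
- have [v vW] := Wk j.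
  pose w (i : 'I_(k + d)) : 'rV[F]_(k + d + d) := match fintype.split i with
    inl l => row_mx (v l) 0 | inr r => row_mx 0 (delta_mx 0 r) end.
  have wl l : w (lshift d l) = row_mx (v l) 0 by rewrite /w (unsplitK (inl _)).
  have wr r : w (rshift k r) = row_mx 0 (delta_mx 0 r).
    by rewrite /w (unsplitK (inr _)).
  exists w => c /W'E[]; rewrite !linear_lin_comb /lin_comb !big_split_ord /=.
  under eq_bigr do rewrite wl row_mxKr scaler0.
  rewrite big1 // add0r; under eq_bigr do rewrite wr row_mxKr.
  rewrite -[X in X = 0 -> _]/(lin_comb _ (fun i => c (rshift k i))).
  rewrite lin_comb_delta => /rowP cr.
  under eq_bigr do rewrite wl row_mxKl.
  rewrite [X in _ + X]big1 => [|i _]; last by rewrite wr row_mxKl scaler0.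
  rewrite addr0 => cl i; case: (split_ordP i) => l ->.
    exact: (vW (fun i => c (lshift d i)) cl l).
  by have := cr l; rewrite !mxE.
- by have [j ?] := Wcov (lsubmx x); exists j; apply/W'E.
Qed.

(** The two previous lemmas combine in a Euclidean descent on k, which keeps
    the dimension d of the members fixed. The bound on N says that a cover by N
    members would not have enough vectors, so that the cover by N.+1 members is
    optimal. *)
Lemma finite_cover (F : finFieldType) (k d : nat) : (0 < k)%N -> (0 < d)%N ->
  exists2 N, (N * (#|F| ^ d).-1 < (#|F| ^ (k + d)).-1)%N &
    has_cover k 'rV[F]_(k + d) 'I_N.+1.
Proof.
move=> k0 d0; have q1 := finField_gt1 F.
elim/ltn_ind: k k0 => k IH k0; have [kd|dk] := leqP k d.
  exists (#|F| ^ k)%N.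
    have qk : (1 < #|F| ^ k)%N by rewrite -[1%N](expn0 #|F|) ltn_exp2l.
    rewrite -subn1 mulnBr muln1 -expnD -subn1.
    by apply: ltn_sub2l => //; rewrite -[1%N](expn0 #|F|) ltn_exp2l // addn_gt0 k0.
  apply: has_cover_le (spread_base F _); last by rewrite k0.
  by apply: card_le_fin; rewrite card_sum card_unit card_mx mul1n addn1.
have [k' kE] : exists k', k = (k' + d)%N by exists (k - d)%N; rewrite subnK // ltnW.
subst k; have k'0 : (0 < k')%N by rewrite -(ltn_add2r d).
have [|N NN cN] := IH k' _ k'0; first by rewrite -[X in (X < _)%N]addn0 ltn_add2l.
exists (#|F| ^ (k' + d) + N)%N.
  move: NN; rewrite (expnD _ (k' + d) d).
  have : (0 < #|F| ^ d)%N by rewrite expn_gt0 ltnW.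
  case: (#|F| ^ d)%N => // b _ /=; rewrite mulnDl mulnS.
  by move: (#|F| ^ (k' + d))%N (N * b)%N => a c ac; lia.
apply: has_cover_le (spread_rec d0 cN).
by apply: card_le_fin; rewrite card_sum card_ord card_mx mul1n addnS.
Qed.

(** The index set is that of all vectors rather than that of the lines: over an
    infinite field, both have the cardinality of F. *)
Lemma lines_cover (F : fieldType) (k : nat) : has_cover k 'rV[F]_k.+1 'rV[F]_k.+1.
Proof.
have /choice[W WE] := fun v : 'rV[F]_k.+1 => line_submod v.
exists W; split=> [v|v]; last by exists v; apply/WE; exists 1; rewrite scale1r.
(* The basis vectors other than the j-th one are independent modulo v. *)
have [j vj] : exists j : 'I_k.+1, v 0 j = 0 -> v = 0.
  have [->|/rV0Pn[j vj]] := eqVneq v 0; first by exists ord0.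
  by exists j => /eqP; rewrite (negPf vj).
exists (fun i => delta_mx 0 (lift j i)) => c /WE[a E] i.
have /rowP/(_ j) := E; rewrite summxE big1 => [|l _]; last first.
  by rewrite !mxE (negPf (neq_lift _ _)) andbF mulr0.
rewrite mxE => /esym/eqP; rewrite mulf_eq0 => av.
have {}E : lin_comb (fun i => delta_mx 0 (lift j i)) c = 0 :> 'rV[F]_k.+1.
  by rewrite E; case/orP: av => /eqP => [->|/vj->]; rewrite ?scale0r ?scaler0.
have /rowP/(_ (lift j i)) := E; rewrite summxE (bigD1 i) //= !mxE !eqxx mulr1.
rewrite big1 ?addr0 // => l li.
by rewrite !mxE (inj_eq lift_inj) eq_sym (negPf li) andbF mulr0.
Qed.

(** The subspaces of the vectors whose coordinates vanish from the n-th one on,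
    along a sequence of basis elements, are increasing and exhaust V, because a
    vector has finitely many nonzero coordinates. *)
Lemma coordinate_cover (F : fieldType) (V : lmodType F) (k : nat) :
  infinite_set (vdim (fullsubmod V)) -> has_cover k V nat.
Proof.
have fullE : [set` fullsubmod V] = [set: V] by apply/seteqP.
have Bb := vdimP (fullsubmod V); rewrite fullE in Bb.
move=> /infiniteP/card_leTP[e [ei eB]].
have [l [lin le lfin]] := coord_family Bb ei eB.
have /choice[W WE] : forall n, exists W : submodClosed V,
    forall x, x \in W <-> forall p, (n <= p)%N -> l p x = 0.
  move=> n; apply: submod_of_set; split=> [p _|a x y xW yW p np].
    by have := lin p (-1) 0 0; rewrite scaler0 addr0 mulN1r addNr.
  by rewrite lin xW // yW // mulr0 addr0.
exists W; split=> [n|x]; last first.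
  have /finite_fsetP[s sE] := lfin x.
  exists (\max_(p <- s) p).+1; apply/WE => p np; apply: contrapT => lp.
  have ps : p \in s by have : [set t | l t x <> 0] p by []; rewrite sE.
  by move: np; rewrite ltnNge leq_bigmax_seq.
exists (fun i => e (n + i)%N) => c /WE cW i.
have := cW (n + i)%N (leq_addr _ _).
have [f fE] : exists f : {linear V -> F^o}, forall x, f x = l (n + i)%N x.
  by apply: linear_pack => a x y; apply: lin.
rewrite -fE linear_lin_comb /lin_comb (bigD1 i) //= fE le asboolT //.
rewrite -[_ *: 1]/(_ * 1) mulr1 big1 ?addr0 // => j ij.
rewrite fE le asboolF ?scaler0 // => /addnI/val_inj ji.
by rewrite ji eqxx in ij.
Qed.

(** * Lower bounds *)

(** Each element of W can be shifted by the linear combinations of k vectors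
    that are independent modulo W, without collision. *)
Lemma card_codim_le (F : finFieldType) (a b k : nat)
    (W : submodClosed 'M[F]_(a, b)) :
  codim_ge W k -> (#|[pred x in W]| * #|F| ^ k <= #|F| ^ (a * b))%N.
Proof.
move=> [v vW]; rewrite -card_mx.
have <- : #|{: 'rV[F]_k}| = (#|F| ^ k)%N by rewrite card_mx mul1n.
rewrite -(cardX [pred x in W] (mem {: 'rV[F]_k})).
pose h (p : 'M[F]_(a, b) * 'rV[F]_k) := p.1 + lin_comb v (p.2 0).
have hinj : {in [predX [pred x in W] & {: 'rV[F]_k}] &, injective h}.
  move=> [x c] [y d] /andP[/= xW _] /andP[/= yW _]; rewrite /h /= => E.
  have cd : c = d.
    apply/rowP => i; apply/eqP; rewrite -subr_eq0; apply/eqP.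
    have := vW (fun i => (-1 *: d + c) 0 i); rewrite lin_combD scaleN1r.
    have -> : lin_comb v (c 0) = y + lin_comb v (d 0) - x.
      by rewrite -E addrAC subrr add0r.
    rewrite addrA addrCA addNr addr0.
    have yxW : y - x \in W by rewrite -scaleN1r rpredD ?rpredZ.
    by move=> /(_ yxW i); rewrite !mxE mulN1r addrC.
  by move: E; rewrite cd => /addIr ->.
by rewrite -(card_in_imset hinj); apply: max_card.
Qed.

(** The nonzero vectors are distributed among n subspaces, each having at most
    #|F| ^ (a * b - k) - 1 of them; both sides are multiplied by #|F| ^ k to
    avoid the subtraction in the exponent. *)
Lemma cover_count (F : finFieldType) (a b k n : nat) :
  has_cover k 'M[F]_(a, b) 'I_n ->
  ((#|F| ^ (a * b)).-1 * #|F| ^ k <= n * (#|F| ^ (a * b) - #|F| ^ k))%N.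
Proof.
move=> [W [Wk Wcov]]; rewrite -card_mx.
pose w i := #|[pred x in W i]|.
have wE i : w i = #|[pred x | (x \in W i) && (x != 0)]|.+1.
  rewrite /w (cardD1 0) inE rpred0 add1n; congr _.+1.
  by apply: eq_card => x; rewrite !inE andbC.
have le1 : (#|{: 'M[F]_(a, b)}|.-1 <= \sum_(i < n) (w i).-1)%N.
  rewrite (cardD1 0) inE /= add0n.
  under [X in (_ <= X)%N]eq_bigr do rewrite wE /= -sum1_card big_mkcond.
  rewrite exchange_big -sum1_card big_mkcond /=; apply: leq_sum => x _.
  case: ifP => // /andP[x0 _]; have [i xi] := Wcov x.
  by rewrite (bigD1 i) //= inE xi x0.
apply: (@leq_trans (\sum_(i < n) (w i).-1 * #|F| ^ k)).
  by rewrite -big_distrl leq_mul2r le1 orbT.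
rewrite -[X in (_ <= X * _)%N](card_ord n) -sum_nat_const; apply: leq_sum => i _.
rewrite -subn1 mulnBl mul1n leq_sub2r // card_mx.
exact: card_codim_le.
Qed.

(** The curve t |-> \sum_j t ^ j v_j meets each W i in fewer than n points: by
    the invertibility of Vandermonde matrices, n points of the curve span all
    the v_j. A point of the curve is thus determined by some W i that contains
    it and by its rank among the points of the curve in W i. *)
Lemma moment_curve (F : fieldType) (V : lmodType F) (I : Type) (n : nat)
    (v : 'I_n -> V) (W : I -> submodClosed V) :
  (forall i, exists j, v j \notin W i) -> (forall x, exists i, x \in W i) ->
  [set: F] #<= [set: I * 'I_n].
Proof.
move=> vW Wcov; pose curve t := lin_comb v (fun j => t ^+ j).
pose T i := [set t | curve t \in W i].
have Tn i : T i #<= `I_n.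
  have [/card_leIP[t [ti tT]]|//] := card_le_total `I_n (T i).
  have [j /negP[]] := vW i.
  pose M := (Vandermonde n (\row_l t l))^T.
  have MU : M \in unitmx.
    rewrite unitmx_tr unitmxE det_Vandermonde unitfE.
    apply/prodf_neq0 => l _; apply/prodf_neq0 => l' ll'.
    rewrite !mxE subr_eq0; apply: contraTneq ll' => /ti ->.
    by rewrite ltnn.
  have -> : v j = \sum_l (invmx M) j l *: curve (t l).
    transitivity (\sum_j' (invmx M *m M) j j' *: v j').
      rewrite mulVmx // (bigD1 j) //= big1 ?addr0 => [|l lj].
        by rewrite !mxE eqxx scale1r.
      by rewrite !mxE eq_sym (negPf lj) scale0r.
    under eq_bigr do rewrite mxE scaler_suml.
    rewrite exchange_big; apply: eq_bigr => l _.
    rewrite scaler_sumr; apply: eq_bigr => j' _.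
    by rewrite scalerA !mxE.
  by apply: rpred_sum => l _; rewrite rpredZ //; apply: tT.
have /choice[r rP] : forall i, exists r : F -> 'I_n,
    forall t t', T i t -> T i t' -> r t = r t' -> t = t'.
  move=> i; have [j0 _] := vW i.
  have := Tn i; rewrite (card_le_eqr card_II) => /(card_le_exinj j0)[r [_ ?]].
  by exists r.
have /choice[ix ixP] := fun t => Wcov (curve t).
apply/card_leTT; exists (fun t => (ix t, r (ix t) t)) => t t' [E].
by rewrite -E => /rP; apply; [exact: ixP|rewrite /T /= E; exact: ixP].
Qed.

(** * Counting lines over a finite field *)

Lemma fullsubmodE (F : fieldType) (V : lmodType F) : [set` fullsubmod V] = [set: V].
Proof. exact/seteqP. Qed.

Lemma vdim_full_enum (F : fieldType) (V : lmodType F) n :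
  vdim (fullsubmod V) #= `I_n -> exists v : 'I_n -> V,
    injective (fun c : 'rV[F]_n => lin_comb v (c 0)) /\
    forall x, exists c : 'rV[F]_n, lin_comb v (c 0) = x.
Proof.
move=> /vdim_eqP[v vI vV]; exists v; split=> [|x]; first exact: lin_comb_inj.
by have [c ->] := (vV x).1 isT; exists (\row_i c i); rewrite lin_comb_row.
Qed.

Lemma vdim_finite (F : fieldType) (V : lmodType F) :
  finite_set [set: V] -> exists n, vdim (fullsubmod V) #= `I_n.
Proof. by apply: sub_finite_set. Qed.

Section CountingLines.
Variable F : finFieldType.
Implicit Type V : lmodType F.

Lemma card_vdim V n : vdim (fullsubmod V) #= `I_n -> [set: V] #= `I_(#|F| ^ n).
Proof.
move=> /vdim_full_enum[v [vi vs]].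
by have := card_fin_eq vi vs; rewrite card_mx mul1n.
Qed.

Lemma linesP V (L : set V) :
  lines V L <-> exists2 v, v != 0 & L = [set x | exists a : F, x = a *: v].
Proof.
split=> [[M /vdim_eqP[v vI vM] <-]|[v v0 ->]].
  exists (v ord0).
    apply/eqP => v0; have /(_ _ ord0)/eqP := vI (fun=> 1).
    by rewrite /lin_comb big_ord1 v0 scaler0 oner_eq0 => /(_ erefl).
  apply/seteqP; split=> [x /vM[c ->]|x [a ->]].
    by exists (c ord0); rewrite /lin_comb big_ord1.
  by apply/vM; exists (fun=> a); rewrite /lin_comb big_ord1.
have [M ME] := line_submod v.
exists M; last by apply/seteqP; split=> x /ME.
apply/vdim_eqP; exists (fun=> v) => [c|x].
  rewrite /lin_comb big_ord1 => /eqP; rewrite scaler_eq0 (negPf v0) orbF.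
  by move=> /eqP c0 i; rewrite ord1.
rewrite ME; split=> [[a ->]|[c ->]]; last by exists (c ord0); rewrite /lin_comb big_ord1.
by exists (fun=> a); rewrite /lin_comb big_ord1.
Qed.

(** The nonzero vectors are partitioned by the lines, each of which consists of
    #|F|.-1 multiples of a generator. *)
Lemma card_lines V N : [set: V] #= `I_N ->
  (#|` fset_set (lines V)| * #|F|.-1 = N.-1)%N.
Proof.
move=> VN; have Vfin : finite_set [set: V] by exists N.
have lfin : finite_set (lines V).
  apply: (@sub_finite_set _ _
    ((fun v => [set x | exists a : F, x = a *: v]) @` [set: V])).
    by move=> L /linesP[v _ ->]; exists v.
  exact: finite_image.
have /choice[g gP] : forall L : set V, exists v, lines V L ->
    v != 0 /\ L = [set x | exists a : F, x = a *: v].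
  move=> L; have [/linesP[v v0 Lv]|nL] := pselect (lines V L); last by exists 0.
  by exists v.
pose Ls := fset_set (lines V); pose A := (fset_set [set: V] `\ 0)%fset.
have LsP L : L \in Ls <-> lines V L by rewrite in_fset_set //; split=> [/set_mem|/mem_set].
pose ks := [seq a <- enum F | a != 0].
have ksz : size ks = #|F|.-1.
  by rewrite -(cardC1 (0 : F)) cardE /enum_mem -enumT; congr size; apply: eq_filter.
have AN : #|` A| = N.-1.
  have := card_fset_set VN.
  by rewrite (cardfsD1 0) in_fset_set // mem_set // => <-.
rewrite -ksz -AN -(size_allpairs (fun L a => a *: g L) Ls ks).
apply/perm_size/uniq_perm; [|exact: fset_uniq|move=> x].
  apply: allpairs_uniq; [exact: fset_uniq|by rewrite filter_uniq ?enum_uniq|].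
  move=> p q /allpairsP[[L a] [/= /LsP LL]]; rewrite mem_filter => /andP[a0 _] ->.
  move=> /allpairsP[[M b] [/= /LsP MM]]; rewrite mem_filter => /andP[b0 _] -> /= E.
  have [gL LE] := gP _ LL; have [gM ME] := gP _ MM.
  have LM : L = M.
    rewrite LE ME; apply/seteqP; split=> x [c ->].
      exists (c * (a^-1 * b)).
      by rewrite -scalerA -scalerA -E (scalerA a^-1) mulVf // scale1r.
    exists (c * (b^-1 * a)).
    by rewrite -scalerA -scalerA E (scalerA b^-1) mulVf // scale1r.
  congr (_, _) => //; subst M; apply/eqP; rewrite -subr_eq0.
  have : (a - b) *: g L == 0 by rewrite scalerBl E subrr.
  by rewrite scaler_eq0 (negPf gL) orbF.
rewrite in_fsetD1 in_fset_set // mem_set // andbT.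
apply/allpairsP/idP => [[[L a] [/= /LsP LL]]|x0].
  rewrite mem_filter => /andP[a0 _] ->; have [gL _] := gP _ LL.
  by rewrite scaler_eq0 negb_or a0.
pose L := [set y | exists a : F, y = a *: x].
have LL : lines V L by apply/linesP; exists x.
have [gL LE] := gP _ LL.
have [a xa] : exists a : F, x = a *: g L.
  suff : L x by rewrite {1}LE.
  by exists 1; rewrite scale1r.
exists (L, a); split=> //=; first exact/LsP.
rewrite mem_filter mem_enum andbT.
by apply: contra x0 => /eqP a0; rewrite xa a0 scale0r.
Qed.

(** As a set, V is the product of U and of the quotient; counting both sides
    gives the dimension of the quotient. *)
Lemma vdim_lquot V (U : submodClosed V) n k : vdim (fullsubmod V) #= `I_n ->
  vdim U #= `I_k -> exists2 d, n = (k + d)%N & [set: lquot U] #= `I_(#|F| ^ d).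
Proof.
move=> Vn /vdim_eqP[u uI uU].
have Vq := card_vdim Vn.
have [d qd] : exists d, vdim (fullsubmod (lquot U)) #= `I_d.
  apply: vdim_finite.
  have -> : [set: lquot U] = (\pi_(lquot U))%qT @` [set: V].
    by apply/seteqP; split=> // z _; exists (repr z) => //; rewrite reprK.
  by apply: finite_image; exists (#|F| ^ n)%N.
exists d; last exact: card_vdim.
have [w [wi ws]] := vdim_full_enum qd.
pose h (p : 'rV[F]_k * 'rV[F]_d) := lin_comb u (p.1 0) + repr (lin_comb w (p.2 0)).
have piU x z : x \in U -> (\pi_(lquot U) (x + repr z) = z)%qT.
  move=> xU; rewrite -[RHS]reprK; apply/pi_lquot_eq.
  by rewrite addrK.
have uUc c : lin_comb u c \in U by apply/uU; exists c.
have hi : injective h.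
  move=> [a b] [a' b'] E.
  have bb : b = b'.
    apply: wi; have := congr1 (\pi_(lquot U))%qT E.
    by rewrite /h /= !piU.
  by move: E; rewrite bb /h /= => /addIr/(lin_comb_inj uI) ->.
have hs x : exists p, h p = x.
  have [b bE] := ws (\pi_(lquot U) x)%qT.
  have /uU[c cE] : x - repr (\pi_(lquot U) x)%qT \in U.
    by apply/pi_lquot_eq; rewrite reprK.
  by exists (\row_i c i, b); rewrite /h /= bE lin_comb_row -cE subrK.
have := card_fin_eq hi hs; rewrite card_prod !card_mx !mul1n -expnD.
rewrite (card_eql Vq) => /card_eq_II/eqP.
by rewrite eqn_exp2l ?finField_gt1 // => /eqP.
Qed.

Lemma absz_ceil_le (p1 p2 m : nat) : (0 < p2)%N ->
  (`|Num.ceil ((p1%:R : rat) / p2%:R)| <= m)%N = (p1 <= m * p2)%N.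
Proof.
move=> p20; have c0 : 0 <= Num.ceil ((p1%:R : rat) / p2%:R).
  by rewrite ceil_ge0 (lt_le_trans (ltrN10 _)) // divr_ge0 ?ler0n.
rewrite -lez_nat gez0_abs // ceil_le_int ler_pdivrMr ?ltr0n //.
by rewrite -pmulrn -natrM ler_nat.
Qed.

(** The factor #|F|.-1 between lines and nonzero vectors cancels in the
    quotient that defines nu_fin. Comparing nu_fin with every m avoids a closed
    formula for the ceiling. *)
Lemma nu_fin_le V k d m : (0 < d)%N ->
  vdim (fullsubmod V) #= `I_(k + d) ->
  (nu_fin V k <= m)%N = ((#|F| ^ (k + d)).-1 <= m * (#|F| ^ d).-1)%N.
Proof.
move=> d0 Vn; rewrite /nu_fin.
have P1 := card_lines (card_vdim Vn).
have P2 : (card_lines_quot V k * #|F|.-1 = (#|F| ^ d).-1)%N.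
  rewrite /card_lines_quot; set S := [set _ | U in _]%classic.
  have [U Uk <-] : S (get S).
    apply: getPex.
    have [v vI vU] : exists2 v : 'I_k -> V, (forall i, [set: V] (v i)) & indep v.
      have Bb := vdimP (fullsubmod V); rewrite fullsubmodE in Bb.
      apply/(card_le_basis _ Bb); rewrite (card_le_eqr Vn) card_le_II; exact: leq_addr.
    have [U UE] := span_submod v.
    exists #|` fset_set (lines (lquot U))|; exists U => //.
    by apply/vdim_eqP; exists v.
  have [d' /addnI <-] := vdim_lquot Vn Uk.
  exact: card_lines.
have q1 := finField_gt1 F.
have qd1 : (0 < (#|F| ^ d).-1)%N.
  by rewrite -subn1 subn_gt0 -[1%N](expn0 #|F|) ltn_exp2l.
have q10 : (0 < #|F|.-1)%N by rewrite -subn1 subn_gt0.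
have p20 : (0 < card_lines_quot V k)%N.
  by move: qd1; rewrite -P2 muln_gt0 => /andP[].
by rewrite absz_ceil_le // -P1 -P2 mulnA leq_pmul2r.
Qed.
End CountingLines.

(** * The minimal number of subspaces *)

Lemma has_cover_fin (F : fieldType) (V : lmodType F) (I : Type) (k : nat) :
  finite_set [set: I] -> has_cover k V I ->
  exists2 m, [set: 'I_m] #<= [set: I] & has_cover k V 'I_m.
Proof.
move=> [m Im] cV; have [f fi fs] := card_eqI_enum Im; exists m.
  by apply/card_leTT; exists f.
apply: (has_cover_reindex (g := f)) cV => i.
by have : [set: I] i by []; rewrite fs => -[j _ ?]; exists j.
Qed.

Section FiniteField.
Variables (F : finFieldType) (V : lmodType F) (k : nat).
Hypothesis k0 : (0 < k)%N.

Lemma finite_space_cover (I : Type) (n : nat) :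
  vdim (fullsubmod V) #= `I_n -> (k < n)%N ->
  has_cover k V I <-> [set: 'I_(nu_fin V k)] #<= [set: I].
Proof.
move=> Vn kn; have [d dE] : exists d, n = (k + d)%N.
  by exists (n - k)%N; rewrite subnKC // ltnW.
subst n; have d0 : (0 < d)%N by rewrite -(ltn_add2l k) addn0.
have q1 := finField_gt1 F.
split=> [cV|]; last first.
  have [N NN cN] := finite_cover F k0 d0.
  have NI : (N < nu_fin V k)%N by rewrite ltnNge (nu_fin_le _ d0 Vn) -ltnNge.
  move=> nI; apply: (@has_cover_le _ _ _ _ 'I_N.+1).
    by apply: card_le_trans nI; apply: card_le_fin; rewrite card_ord.
  have [|f fs] := @coord_map F V (k + d); first by rewrite (card_le_eqr Vn).
  exact: has_cover_pullback fs cN.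
have [Ifin|Iinf] := pselect (finite_set [set: I]); last exact: card_fin_le.
have [m mI cm] := has_cover_fin Ifin cV.
apply: card_le_trans mI; apply: card_le_fin; rewrite card_ord (nu_fin_le _ d0 Vn).
have [v [_ vs]] := vdim_full_enum Vn.
have vlin : linear (fun c : 'rV[F]_(k + d) => lin_comb v (c 0)).
  by move=> a x y; rewrite lin_combD.
have [f fE] := linear_pack vlin.
have fs y : exists x, f x = y by have [x <-] := vs y; exists x; rewrite fE.
have := cover_count (has_cover_pullback fs cm); rewrite mul1n expnD.
have qk : (0 < #|F| ^ k)%N by rewrite expn_gt0 ltnW.
have -> : (#|F| ^ k * #|F| ^ d - #|F| ^ k = #|F| ^ k * (#|F| ^ d).-1)%N.
  by rewrite -subn1 mulnBr muln1.
by rewrite mulnCA mulnC leq_pmul2l.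
Qed.

(** For the lower bound, the cover is restricted to the finite-dimensional
    space spanned by all the vectors that witness the codimensions, which is
    parametrized by m x k matrices. Counting there gives #|F| ^ k < m,
    because Q - 1 exceeds Q - #|F| ^ k, whatever the cardinality Q of the
    matrix space. *)
Lemma finite_field_cover (I : Type) : infinite_set [set: V] ->
  has_cover k V I <-> [set: k.-tuple F + unit] #<= [set: I].
Proof.
move=> Vinf; have q1 := finField_gt1 F.
have cardT : #|{: k.-tuple F + unit}| = (#|F| ^ k).+1.
  by rewrite card_sum card_unit card_tuple addn1.
split=> [cV|tI]; last first.
  apply: has_cover_le tI _; apply: (@has_cover_le _ _ _ _ ('rV[F]_k + unit)%type).
    apply: (@card_le_trans _ _ _ [set: 'I_((#|F| ^ k).+1)]).
      by apply: card_le_fin; rewrite card_sum card_unit card_mx mul1n addn1.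
    by apply/card_leTT; rewrite -cardT; exists enum_val; exact: enum_val_inj.
  have [|f fs] := @coord_map F V (k + k); last first.
    by apply: has_cover_pullback fs (spread_base F _); rewrite k0 leqnn.
  have : infinite_set (vdim (fullsubmod V)).
    by move=> [n Vn]; apply: Vinf; exists (#|F| ^ n)%N; apply: card_vdim.
  by move=> /infiniteP; apply: card_le_trans; exact: card_leT.
have [Ifin|Iinf] := pselect (finite_set [set: I]); last first.
  apply: card_le_trans (card_fin_le Iinf (#|F| ^ k).+1).
  by apply: card_le_fin; rewrite cardT.
have [m mI [W [Wk Wcov]]] := has_cover_fin Ifin cV.
apply: card_le_trans mI; apply: card_le_fin; rewrite cardT.
have /choice[v vW] := Wk.
have flin : linear (fun A : 'M[F]_(m, k) => \sum_i lin_comb (v i) (A i)).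
  move=> a A B; rewrite scaler_sumr -big_split; apply: eq_bigr => i _ /=.
  rewrite /lin_comb scaler_sumr -big_split; apply: eq_bigr => j _ /=.
  by rewrite !mxE scalerDl scalerA.
have [f fE] := linear_pack flin.
have fv i j : f (delta_mx i j) = v i j.
  rewrite fE (bigD1 i) //= [X in _ + X]big1 ?addr0 => [|l li]; last first.
    by apply: big1 => r _; rewrite mxE (negPf li) scale0r.
  rewrite /lin_comb (bigD1 j) //= mxE !eqxx scale1r big1 ?addr0 // => l lj.
  by rewrite mxE (negPf lj) andbF scale0r.
have cM : has_cover k 'M[F]_(m, k) 'I_m.
  apply: (has_cover_preimage (f := f)) Wcov => i.
  exists (fun j => delta_mx i j) => c.
  by rewrite (eq_lin_comb (w := v i)) => [|j]; [exact: vW|exact: fv].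
have := cover_count cM; rewrite ltnNge.
have : (#|F| ^ k <= #|F| ^ (m * k))%N.
  have [i _] := Wcov 0; rewrite leq_exp2l // leq_pmull //.
  by case: (m) i => // -[].
have : (1 < #|F| ^ k)%N by rewrite -[1%N](expn0 #|F|) ltn_exp2l.
move: (#|F| ^ (m * k))%N (#|F| ^ k)%N => Q q q2 Q1; apply: contraL => mq.
rewrite -ltnNge; apply: (@leq_ltn_trans (q * (Q - q))%N); first exact: leq_mul.
by rewrite mulnC ltn_pmul2r; lia.
Qed.
End FiniteField.

Section InfiniteField.
Variables (F : fieldType) (V : lmodType F) (k : nat).
Hypotheses (k0 : (0 < k)%N) (Finf : infinite_set [set: F]).

Lemma cover_misses_some n (v : 'I_n -> V) (W : submodClosed V) :
  (forall x, exists c : 'rV[F]_n, lin_comb v (c 0) = x) -> codim_ge W k ->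
  exists j, v j \notin W.
Proof.
move=> vs [u uW]; apply: contrapT => nv.
have : lin_comb u (fun=> 1) \in W.
  have [c <-] := vs (lin_comb u (fun=> 1)).
  apply: rpred_sum => j _; apply: rpredZ; apply: contrapT => /negP vj.
  by apply: nv; exists j.
by move=> /uW/(_ (Ordinal k0))/eqP; rewrite oner_eq0.
Qed.

(** Here F, its powers and F^k + 1 have the same cardinality, so that k only
    matters through 0 < k and k < n. *)
Lemma fin_dim_cover (I : Type) n : vdim (fullsubmod V) #= `I_n -> (k < n)%N ->
  has_cover k V I <-> [set: k.-tuple F + unit] #<= [set: I].
Proof.
move=> Vn kn; split=> [[W [Wk Wcov]]|tI].
  have [v [_ vs]] := vdim_full_enum Vn.
  have vW i : exists j, v j \notin W i by exact: cover_misses_some vs (Wk i).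
  have FI := moment_curve vW Wcov.
  have Iinf : infinite_set [set: I].
    move=> Ifin; apply: Finf; apply: card_le_finite FI _.
    by rewrite -setXTT; apply: finite_setX.
  apply: card_le_trans (card_le_trans FI _); last first.
    by apply: card_prod_le => //; exact: card_fin_le.
  apply: card_sum_unit_le => //.
  by apply: (card_seq_le Finf (n := k) (s := val)) => [|t]; [exact: val_inj|exact: size_tuple].
apply: has_cover_le tI _.
apply: (@has_cover_le _ _ _ _ 'rV[F]_k.+1).
  apply: (@card_le_trans _ _ _ [set: F]).
    pose s (r : 'rV[F]_k.+1) := [seq r 0 i | i <- enum 'I_k.+1].
    apply: (card_seq_le Finf (n := k.+1) (s := s)) => [r r' E|r]; last first.
      by rewrite size_map size_enum_ord.
    by apply/rowP => i; move/eq_in_map: E; apply; rewrite mem_enum.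
  apply/card_leTT; exists (fun x => inl (nseq_tuple k x)) => x y [].
  by case: (k) k0 => // k' _ [].
have [|f fs] := @coord_map F V k.+1.
  by rewrite (card_le_eqr Vn) card_le_II.
exact: has_cover_pullback fs (lines_cover F k).
Qed.

(** A finite cover would confine F to a finite set, by the moment curve
    through one vector outside of each member. *)
Lemma inf_dim_cover (I : Type) : infinite_set (vdim (fullsubmod V)) ->
  has_cover k V I <-> [set: nat] #<= [set: I].
Proof.
move=> Vinf; split=> [cV|nI]; last exact: has_cover_le nI (coordinate_cover _ Vinf).
apply/infiniteP => Ifin; have [m _ [W [Wk Wcov]]] := has_cover_fin Ifin cV.
have /choice[v vW] : forall i, exists x, x \notin W i.
  move=> i; have [u uW] := Wk i; exists (lin_comb u (fun=> 1)).
  by apply/negP => /uW/(_ (Ordinal k0))/eqP; rewrite oner_eq0.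
apply: Finf; apply: card_le_finite (moment_curve _ Wcov) _.
  by move=> i; exists i; apply: vW.
exact: finite_finset.
Qed.
End InfiniteField.

Theorem theorem1p2 (F : fieldType) (V : lmodType F) (I : Type) (k : nat)
    (k_ge1 : (1 <= k)%N) (k_lt_dim : ~ (vdim (fullsubmod V) #<= `I_k)) :
  (exists W : I -> submodClosed V,
     [/\ forall i, [set` W i] <> [set: V],
         forall i, `I_k #<= codim (W i) &
         [set: V] = \bigcup_i [set` W i]])
  <-> [set: nu V k] #<= [set: I].
Proof.
rewrite (has_coverP _ _ k_ge1).
have kn n : vdim (fullsubmod V) #= `I_n -> (k < n)%N.
  by move=> Vn; rewrite ltnNge -card_le_II -(card_le_eql Vn); apply/negP.
have [Ffin|Finf] := pselect (finite_set [set: F]).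
  have [Ff FE] := finField_pack Ffin; subst F.
  rewrite /nu; case: pselect => [Vfin|Vinf].
    have [n Vn] := vdim_finite Vfin.
    exact: finite_space_cover Vn (kn n Vn).
  case: pselect => [[]//|?].
  exact: finite_field_cover.
have Vinf : infinite_set [set: V].
  move=> Vfin; have [n Vn] := vdim_finite Vfin.
  have [v [vi _]] := vdim_full_enum Vn.
  apply/Finf/(card_le_finite _ Vfin)/card_leTT.
  exists (fun a => lin_comb v ((const_mx a : 'rV_n) 0)) => a b /vi/rowP.
  by move=> /(_ (Ordinal (leq_ltn_trans (leq0n k) (kn n Vn)))); rewrite !mxE.
rewrite /nu; case: pselect => // ?; case: pselect => [[? dinf]|dfin].
  exact: inf_dim_cover.
have [n Vn] : finite_set (vdim (fullsubmod V)).
  by apply: contrapT => ?; apply: dfin.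
exact: fin_dim_cover Vn (kn n Vn).
Qed.
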